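(* Let $I$ be a calibrated $\sigma$-ideal on a compactum $X$ without isolated points, containing all singletons of $X$, and let $f:B\to Y$ be a Borel map from a Borel set $B\in Bor(X)\setminus I$ to a compactum $Y$ without isolated points. Then: (i) there exists a compact meager set $C\subseteq Y$ with $f^{-1}(C)\notin I$; (ii) if $Y$ is countable-dimensional, there is a zero-dimensional compactum $C\subseteq Y$ with $f^{-1}(C)\notin I$; (iii) for any $\sigma$-finite nonatomic Borel measure $\mu$ on $Y$, there is a compact set $C\subseteq Y$ with $\mu(C)<\infty$ and $f^{-1}(C)\notin I$.
   Context: A compactum is a compact metrizable space. $Bor(X)$ is the $\sigma$-algebra of Borel sets in $X$ and $K(X)$ is the collection of compact subsets of $X$. A $\sigma$-ideal on $X$ is a collection $I\subseteq Bor(X)$ closed under taking Borel subsets and under countable unions of its elements. It is generated by compact sets if every element of $I$ is contained in a $\sigma$-compact set belonging to $I$. A $\sigma$-ideal $I$ on $X$ generated by compact sets is calibrated if for any $K\in K(X)\setminus I$ and any $K_n\in I\cap K(X)$, $n\in\mathbb{N}$, there is a compact set $L\subseteq K\setminus\bigcup_{n\in\mathbb{N}}K_n$ with $L\notin I$. A compactum is countable-dimensional if it is a union of countably many zero-dimensional subsets. A Borel measure on a compactum $Y$ is a countably additive measure $Bor(Y)\to[0,\infty]$; it is nonatomic if every Borel set $A$ with positive measure contains a Borel set $A'$ with $0<\mu(A')<\mu(A)$. *)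

(* Defs.v *)
From HB Require Import structures.
From mathcomp Require Import all_boot all_order all_algebra.
From mathcomp Require Import all_classical all_reals all_analysis.

Set Implicit Arguments.
Unset Strict Implicit.
Unset Printing Implicit Defensive.

Import Order.TTheory GRing.Theory Num.Theory.

Local Open Scope classical_set_scope.

(* Pointedness is required by measurableType; it only excludes the empty space. *)
#[short(type="pmetricType")]
HB.structure Definition PointedMetric (R : numDomainType) :=
  {T of Metric R T & Pointed T}.

Notation borelType T := (g_sigma_algebraType (@open T)).

Definition Borel (T : ptopologicalType) : set (set T) :=
  @measurable _ (borelType T).

Definition Borel_fun (T U : ptopologicalType) (B : set T) (f : T -> U) : Prop :=
  @measurable_fun _ _ (borelType T) (borelType U) B f.

Section Ideals.
Variable T : ptopologicalType.
Implicit Types (I : set (set T)) (A B K L : set T).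

Definition sigma_ideal I : Prop :=
  [/\ I `<=` @Borel T,
      forall A B, I A -> Borel B -> B `<=` A -> I B &
      forall A : (set T)^nat, (forall n, I (A n)) -> I (\bigcup_n A n)].

Definition sigma_compact A : Prop :=
  exists2 K : (set T)^nat, (forall n, compact (K n)) & A = \bigcup_n K n.

Definition generated_by_compacts I : Prop :=
  forall A, I A -> exists B, [/\ sigma_compact B, I B & A `<=` B].

Definition calibrated I : Prop :=
  forall K (Kn : (set T)^nat),
    compact K -> ~ I K -> (forall n, compact (Kn n) /\ I (Kn n)) ->
  exists L, [/\ compact L, L `<=` K `\` \bigcup_n Kn n & ~ I L].

End Ideals.

Section Topology.
Variable T : topologicalType.

Definition no_isolated_points : Prop := isolated [set: T] = set0.

Definition nowhere_dense (A : set T) : Prop := interior (closure A) = set0.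

Definition meager (A : set T) : Prop :=
  exists2 N : (set T)^nat,
    (forall n, nowhere_dense (N n)) & A = \bigcup_n N n.

(* Existence of a clopen base. The library's zero_dimensional only asks that
   clopen sets separate points, which is weaker for noncompact spaces. *)
Definition clopen_base : Prop :=
  forall (x : T) (U : set T), nbhs x U ->
    exists V : set T, [/\ clopen V, V x & V `<=` U].

End Topology.

(* set_type A carries the subspace topology. *)
Definition zero_dimensional_subset (T : topologicalType) (A : set T) : Prop :=
  clopen_base (set_type A).

Definition countable_dimensional (T : topologicalType) : Prop :=
  exists2 A : (set T)^nat,
    (forall n, zero_dimensional_subset (A n)) & [set: T] = \bigcup_n A n.

Definition nonatomic d (T : measurableType d) (R : realType)
    (mu : set T -> \bar R) : Prop :=
  forall A, measurable A -> (0 < mu A)%E ->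
  exists A', [/\ measurable A', A' `<=` A, (0 < mu A')%E & (mu A' < mu A)%E].

(* Main.v *)
Require Import Defs.
From HB Require Import structures.
From mathcomp Require Import all_boot all_order all_algebra.
From mathcomp Require Import all_classical all_reals all_analysis.

Set Implicit Arguments.
Unset Strict Implicit.
Unset Printing Implicit Defensive.

Import Order.TTheory GRing.Theory Num.Theory.

Local Open Scope classical_set_scope.
Local Open Scope ring_scope.

(** The graph of [f] is a Souslin set in [X * Y].  A Hurewicz-type fusion inside
    this graph builds a tree of pieces whose projections to [Y] shrink along
    branches and, among the children of a node, converge to [snd @` L], where [L]
    is a compact subset of the closure of the piece with [fst @` L] not in [I].
    The limit set [C] in [Y] consists of the compacta [snd @` L] and of the values
    of [f] at the branches; [f^-1(C)] is not in [I] because, if [I]-small compacta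
    [K m] covered it, a branch avoiding every [K m] could be followed through the
    points of the sets [fst @` L].

    Calibration is what makes the compacta [snd @` L] small: given closed sets
    [C n] in [Y] and a compact [M] with [fst @` M] not in [I], there is a compact
    [L] inside [M], with [fst @` L] not in [I], whose projection to [Y] lies in
    some [C n] or misses all of them.  In (i) take for the [C n] a dense sequence
    of points; in (iii) closed sets of small measure covering [Y] up to a null set.
    In (ii), each zero-dimensional [A] has countably many [C n] disjoint from it
    and such that a set missing all of them is totally disconnected; applying
    this to a sequence of such [A] covering [Y], the selection can fall in the
    first alternative only finitely many times, by compactness. *)

(** * Preliminaries on topological spaces *)

Lemma hausdorff_closed_set1 (T : topologicalType) (x : T) :
  hausdorff_space T -> closed [set x].
Proof. by move=> hT; exact/accessible_closed_set1/hausdorff_accessible. Qed.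

(** The 2-adic valuation takes every value infinitely often. In [splitting_exists] this lets each
    point of a dense sequence be approached at arbitrarily small scales. *)
Lemma recurrent_enumeration :
  exists r : nat -> nat, forall k N, exists2 n, (N <= n)%N & r n = k.
Proof.
exists (logn 2) => k N; exists (2 ^ k * (2 * N).+1)%N.
  by rewrite (@leq_trans (2 * N).+1)// ?leq_pmull ?expn_gt0// leqW// leq_pmull.
rewrite mulnC logn_Gauss ?pfactorK//.
by rewrite prime_coprime// dvdn2/= mul2n odd_double.
Qed.

Lemma countType_enumeration (T : countType) (t0 : T) :
  exists e : nat -> T, forall t, exists n, e n = t.
Proof.
exists (fun n => odflt t0 (unpickle n)) => t.
by exists (pickle t); rewrite pickleK.
Qed.

Definition countable_base (T : topologicalType) (b : nat -> set T) :=
  (forall n, open (b n)) /\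
  forall (x : T) U, nbhs x U -> exists2 n, b n x & b n `<=` U.

Section general_topology.
Variable T : topologicalType.
Implicit Types A B C : set T.

Lemma second_countable_base : @second_countable T ->
  exists b : nat -> set T, countable_base b.
Proof.
move=> [D cD [oD bD]].
have /pfcard_geP[D0|[b]] := cD.
  exists (fun=> set0); split=> [_|x U /bD[V [DV _] _]]; first exact: open0.
  by rewrite D0 in DV.
exists b; split=> [n|x U /bD[V [DV Ox] OU]]; first exact/oD/funS.
by have [n _ nV] := @surj _ _ _ _ b V DV; exists n; rewrite nV.
Qed.

Lemma dense_sequence (b : nat -> set T) A : countable_base b -> A !=set0 ->
  exists2 e : nat -> T, (forall n, A (e n)) &
    forall x U, A x -> nbhs x U -> exists n, U (e n).
Proof.
move=> [_ bb] [a Aa].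
have /choice[e eP] : forall n, exists x, A x /\ ((exists2 y, A y & b n y) -> b n x).
  move=> n.
  have [[y Ay bny]|nAb] := pselect (exists2 y, A y & b n y); first by exists y.
  by exists a.
exists e => [n|x U Ax /bb[n bnx bnU]]; first by have [] := eP n.
by exists n; apply: bnU; apply: (eP n).2; exists x.
Qed.

Lemma open_Fsigma (b : nat -> set T) A : regular_space T -> countable_base b ->
  open A ->
  exists2 K : (set T)^nat, (forall n, closed (K n)) & A = \bigcup_n K n.
Proof.
move=> rT [_ bb] oA.
exists (fun n => if `[< closure (b n) `<=` A >] then closure (b n) else set0).
  by move=> n; case: ifP => _; [exact: closed_closure|exact: closed0].
apply/seteqP; split=> [x Ax|x [n _]]; last by case: asboolP => // h; exact: h.
have [V xV VA] : filter_from (nbhs x) closure A.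
  by apply: rT; exact: open_nbhs_nbhs.
have [n bnx bnV] := bb _ _ xV.
exists n => //; case: asboolP => [_|[]]; first exact: subset_closure.
by apply: subset_trans VA; exact: closureS.
Qed.

Lemma closed_decreasing_nonempty (F : (set T)^nat) : compact [set: T] ->
  (forall n, closed (F n)) -> (forall n, F n !=set0) ->
  (forall n, F n.+1 `<=` F n) -> exists x, forall n, F n x.
Proof.
move=> cT cF F0 dF.
have ndF m n : (m <= n)%N -> F n `<=` F m.
  elim: n => [|n IH]; first by rewrite leqn0 => /eqP ->.
  by rewrite leq_eqVlt => /predU1P[->//|/IH]; apply: subset_trans.
pose G := filter_from [set: nat] F.
have FG : Filter G.
  apply: filter_from_filter; first by exists 0%N.
  move=> i j _ _; exists (maxn i j) => // x Fx.
  by split; [apply: ndF Fx; exact: leq_maxl|apply: ndF Fx; exact: leq_maxr].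
have PG : ProperFilter G by apply: filter_from_proper => i _; exact: F0.
have [|x [_ xG]] := cT G PG; first exact: filterT.
exists x => n; apply: cF => O xO.
by have [|y [? ?]] := xG (F n) O _ xO; [exists n|exists y].
Qed.

(** Off [A] only finitely many [F n] matter near a given point, and their union is closed. *)
Lemma closed_locally_finite A (F : (set T)^nat) (P : set nat) : closed A ->
  (forall n, closed (F n)) ->
  (forall x, ~ A x -> exists U N, nbhs x U /\
    forall n, (N <= n)%N -> F n `&` U = set0) ->
  closed (A `|` \bigcup_(n in P) F n).
Proof.
move=> cA cF lF x xAF.
have [Ax|nAx] := pselect (A x); first by left.
have [U [N [xU UF]]] := lF x nAx; right; apply: contrapT => nFx.
pose E := \bigcup_(n in [set n | P n /\ (n < N)%N]) F n.
have cE : closed E.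
  apply: closed_bigcup => [|n _]; last exact: cF.
  by apply: (sub_finite_set _ (finite_II N)) => n [].
have nEx : ~ E x by move=> [n [Pn _] Fnx]; apply: nFx; exists n.
have /xAF[y [AFy [[Uy nAy] nEy]]] : nbhs x (U `&` ~` A `&` ~` E).
  apply: filterI; last first.
    by apply: open_nbhs_nbhs; split => //; exact: closed_openC.
  apply: filterI => //.
  by apply: open_nbhs_nbhs; split => //; exact: closed_openC.
case: AFy => // -[n Pn Fny]; have [Nn|nN] := leqP N n.
  by have := UF n Nn; rewrite -subset0 => /(_ y); apply.
by apply: nEy; exists n.
Qed.

End general_topology.

Lemma prod_countable_base (T U : topologicalType) b1 b2 :
  @countable_base T b1 -> @countable_base U b2 ->
  exists b, @countable_base (T * U)%type b.
Proof.
move=> [b1o bb1] [b2o bb2].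
have [e eP] := countType_enumeration (0%N, 0%N).
exists (fun n => b1 (e n).1 `*` b2 (e n).2); split=> [n|[x y] W].
  rewrite openE => -[x y] [] /= b1x b2y.
  exists (b1 (e n).1, b2 (e n).2); last by [].
  by split; apply: open_nbhs_nbhs; split => //; [exact: b1o|exact: b2o].
move=> [[P Q] []/= /bb1[i ix iP] /bb2[j jx jQ]] PQ.
have [n en] := eP (i, j).
exists n; rewrite en//= => -[u v] []/= /iP Pu /jQ Qv.
exact: PQ.
Qed.

(** * Total disconnectedness and clopen bases in compact spaces *)

Lemma totally_disconnectedP (T : topologicalType) (A : set T) :
  totally_disconnected A <->
  forall E, E `<=` A -> connected E -> forall x y, E x -> E y -> x = y.
Proof.
split=> [tA E EA cE x y Ex Ey|h x Ax].
  have := tA x (EA x Ex) => /seteqP[/(_ y) + _] => ->//.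
  by exists E => //; split.
apply/seteqP; split=> [y [E [Ex EA cE] Ey]|y ->].
  exact/esym/(h E).
exact: connected_component_refl.
Qed.

(** Clopen sets containing [x] are stable under finite intersections. If all of them met [N], their
    traces would cluster at some [z] in [N], contrary to the clopen set that separates [x] from
    [z]. *)
Lemma clopen_avoiding_compact (T : topologicalType) (x : T) (N : set T) :
  compact N -> (forall z, N z -> exists D, [/\ clopen D, D x & ~ D z]) ->
  exists D, [/\ clopen D, D x & D `&` N = set0].
Proof.
move=> cN sep; apply: contrapT => nD.
pose F := filter_from [set D : set T | clopen D /\ D x] (fun D => D `&` N).
have FF : Filter F.
  apply: filter_from_filter; first by exists setT; split => //; exact: clopenT.
  move=> A B [cA Ax] [cB Bx]; exists (A `&` B).
    by split=> //; exact: clopenI.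
  by move=> z [[Az Bz] Nz].
have PF : ProperFilter F.
  apply: filter_from_proper => D [cD Dx]; apply/set0P/eqP => DN.
  by apply: nD; exists D.
have FN : F N by exists setT; [split => //; exact: clopenT|exact: subIsetr].
have [z [Nz zF]] := cN F PF FN.
have [D [cD Dx nDz]] := sep z Nz.
have FD : F D by exists D => //; exact: subIsetl.
have [|t [Dt]] := zF D (~` D) FD; last exact.
by apply: open_nbhs_nbhs; split => //; exact: closed_openC cD.2.
Qed.

(** The quasi-component [Q] of [x] is shown to be connected, so it cannot contain a second point. *)
Lemma compact_totally_disconnected_zero_dimensional (T : topologicalType) :
  hausdorff_space T -> compact [set: T] -> totally_disconnected [set: T] ->
  zero_dimensional T.
Proof.
move=> hT cT /totally_disconnectedP tT x y xy; apply: contrapT => nU.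
pose Q := \bigcap_(D in [set D | clopen D /\ D x]) D.
have Qx : Q x by move=> D [].
have Qy : Q y.
  by move=> D [cD Dx]; apply: contrapT => nDy; apply: nU; exists D.
have cQ : closed Q by apply: closed_bigI => D [[]].
move/eqP: xy; apply; apply: (tT Q) => // B [z Bz] [U oU BU] [C cC BC].
(* A relatively clopen part of [Q] containing [x] is all of [Q]. By normality it has an open
   neighbourhood [V] with closure in [W]; the boundary of [V] misses [Q], so some clopen [D] around
   [x] misses it too, and the intersection of [D] and [V] is clopen. *)
suff key P (W : set T) : open W -> closed P -> Q `&` W = Q `&` P -> W x -> Q `<=` W.
  apply/seteqP; split=> [t|t Qt]; first by rewrite BU => -[].
  have QUC : Q `&` U = Q `&` C by rewrite -BU.
  have [Ux|nUx] := pselect (U x).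
    by rewrite BU; split => //; exact: (key C U).
  have /(_ z) : Q `<=` ~` C.
    apply: (key (~` U)); first exact: closed_openC.
    - exact: open_closedC.
    - apply/seteqP; split=> w [Qw nw]; split=> // w'; apply: nw.
        by have [] : (Q `&` C) w by rewrite -QUC; split.
      by have [] : (Q `&` U) w by rewrite QUC; split.
    - by move=> Cx; apply: nUx; have [] : (Q `&` U) x by rewrite QUC; split.
  by move: Bz; rewrite BC => -[Qz Cz] /(_ Qz).
move=> oW cP QWP Wx.
have cA : closed (Q `&` P) by exact: closedI.
have [A sA AW] : filter_from (set_nbhs (Q `&` P)) closure W.
  apply: (compact_normal hT cT) => //.
  by apply/set_nbhsP; exists W; split => //; rewrite -QWP; exact: subIsetr.
have /set_nbhsP[V [oV QPV VA]] := sA.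
have VW : closure V `<=` W by apply: subset_trans AW; exact: closureS.
have [||D [cD Dx DV]] := @clopen_avoiding_compact T x (closure V `\` V).
- apply: (subclosed_compact _ cT) => //; apply: closedI; first exact: closed_closure.
  exact: open_closedC.
- move=> w [cVw nVw]; apply: contrapT => nD; apply: nVw; apply: QPV.
  rewrite -QWP; split; last exact: VW.
  by move=> D [cD Dx]; apply: contrapT => nDw; apply: nD; exists D.
- idtac.
  have eDV : D `&` V = D `&` closure V.
    apply/seteqP; split=> w [Dw Vw]; split => //; first exact: subset_closure.
    by apply: contrapT => nVw; move: DV; rewrite -subset0 => /(_ w); apply.
  have : Q `<=` D `&` V.
    apply: bigcap_inf; split.
      split; first by apply: openI => //; exact: cD.1.
      by rewrite eDV; apply: closedI; [exact: cD.2|exact: closed_closure].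
    by split => //; apply: QPV; rewrite -QWP.
  move=> QDV w /QDV[_ Vw]; apply: VW; exact: subset_closure.
Qed.

Lemma compact_set_type (T : topologicalType) (C : set T) :
  compact C -> compact [set: set_type C].
Proof.
move=> cC F PF _.
have FC : (set_val @ F) C by apply: (@filterE _ F) => -[a Ca]; exact: set_mem Ca.
have [z [Cz zF]] := cC (set_val @ F) _ FC.
exists (SigSub (mem_set Cz)); split => // A B FA [W [[U oU <-] Uz] WB].
have FA' : (set_val @ F) (set_val @` A).
  by apply: (@filterS _ F _ A) => // a Aa; exists a.
have [|w [[a Aa <-] Ua]] := zF _ U FA'; first by apply: open_nbhs_nbhs.
by exists a; split => //; exact: WB.
Qed.

Lemma zero_dimensional_subset_compact (T : topologicalType) (C : set T) :
  hausdorff_space T -> compact C -> totally_disconnected C ->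
  zero_dimensional_subset C.
Proof.
move=> hT cC /totally_disconnectedP tC x U xU.
have cts : continuous (set_val : set_type C -> T) by exact: initial_continuous.
have hC : hausdorff_space (set_type C).
  rewrite open_hausdorff => a b ab.
  have : set_val a != set_val b by apply: contra ab => /eqP/val_inj ->.
  move: hT; rewrite open_hausdorff => h /h[[P Q]]/= [Pa Qb] [oP oQ PQ].
  exists (set_val @^-1` P, set_val @^-1` Q) => /=; first by rewrite !inE in Pa Qb *.
  split; [by exists P|by exists Q|].
  by rewrite -preimage_setI (eqP PQ) preimage_set0.
have cCC := compact_set_type cC.
have zC : zero_dimensional (set_type C).
  apply: compact_totally_disconnected_zero_dimensional => //.
  apply/totally_disconnectedP => E _ cE a b Ea Eb; apply: val_inj.
  apply: (tC (set_val @` E)).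
  - by move=> _ [w _ <-]; exact: set_valP.
  - by apply: connected_continuous_connected => //; exact: continuous_subspaceT.
  - by exists a.
  - by exists b.
have [D [Dx cD] DU] := zero_dimensional_cvg hC zC cCC xU.
by exists D.
Qed.

(** * Souslin sets *)

(* The Souslin operation on closed sets, with [R n s] depending on finitely many
   values of the branch [s] instead of the usual indexing by [(s 0, ..., s n)]:
   countable unions and intersections then amount to reindexing branches. *)
Definition souslin (T : topologicalType) (A : set T) : Prop :=
  exists R : nat -> (nat -> nat) -> set T,
  [/\ forall n s, closed (R n s),
      forall n s, exists m, forall t,
        (forall i, (i < m)%N -> t i = s i) -> R n t = R n s
    & A = [set x | exists s, forall n, R n s x]].

Section souslin_sets.
Variable T : topologicalType.
Implicit Types A B : set T.

Lemma souslin_closed A : closed A -> souslin A.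
Proof.
move=> cA; exists (fun _ _ => A); split=> //; first by move=> *; exists 0%N.
by apply/seteqP; split=> [x Ax|x [_ /(_ 0%N)]//]; exists id.
Qed.

(** The first value of the branch selects the set, the shifted branch witnesses membership. *)
Lemma souslin_bigcup (A : (set T)^nat) :
  (forall n, souslin (A n)) -> souslin (\bigcup_n A n).
Proof.
move=> /choice[R RP].
exists (fun n s => R (s 0%N) n (s \o succn)); split.
- by move=> n s; have [+ _ _] := RP (s 0%N); apply.
- move=> n s; have [_ /(_ n (s \o succn))[m sm] _] := RP (s 0%N).
  exists m.+1 => t ts; rewrite ts//; apply: sm => i im /=.
  exact: ts.
- apply/seteqP; split=> [x [k _]|x [s sx]].
    have [_ _ ->] := RP k => -[s sx].
    by exists (fun i => if i is j.+1 then s j else k).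
  exists (s 0%N) => //; have [_ _ ->] := RP (s 0%N).
  by exists (s \o succn).
Qed.

(** One branch [s] codes a witness [row s k] for every [A k], and [e] enumerates all conditions on
    all rows. *)
Lemma souslin_bigcap (A : (set T)^nat) :
  (forall n, souslin (A n)) -> souslin (\bigcap_n A n).
Proof.
move=> /choice[R RP].
have [e eP] := countType_enumeration (0%N, 0%N).
pose row (s : nat -> nat) (k i : nat) := s (pickle (k, i)).
exists (fun n s => R (e n).1 (e n).2 (row s (e n).1)); split.
- by move=> n s; have [+ _ _] := RP (e n).1; apply.
- move=> n s; have [_ + _] := RP (e n).1.
  move=> /(_ (e n).2 (row s (e n).1))[m sm].
  exists (\max_(i < m) (pickle ((e n).1, i : nat)).+1) => t ts; apply: sm => i im.
  apply: ts; exact: (leq_bigmax (Ordinal im)).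
- apply/seteqP; split=> [x Ax|x [s sx] k _].
    have /choice[s sP] : forall k, exists s, forall n, R k n s x.
      by move=> k; have [_ _ AE] := RP k; have := Ax k I; rewrite AE.
    pose u n := if unpickle n is Some ki then s ki.1 ki.2 else 0%N.
    exists u => n; rewrite (_ : row u (e n).1 = s (e n).1)//.
    by apply/funext => i; rewrite /row /u pickleK.
  have [_ _ ->] := RP k; exists (row s k) => j.
  by have [n en] := eP (k, j); have := sx n; rewrite en.
Qed.

Lemma souslinU A B : souslin A -> souslin B -> souslin (A `|` B).
Proof.
move=> sA sB; rewrite -bigcup2E; apply: souslin_bigcup => -[|[|n]]//=.
by apply: souslin_closed; exact: closed0.
Qed.

Lemma souslinI A B : souslin A -> souslin B -> souslin (A `&` B).
Proof.
move=> sA sB; rewrite -bigcap2E; apply: souslin_bigcap => -[|[|n]]//=.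
by apply: souslin_closed; exact: closedT.
Qed.

Lemma souslin_preimage (U : topologicalType) (f : U -> T) A :
  continuous f -> souslin A -> souslin (f @^-1` A).
Proof.
move=> cf [R [cR Rm AE]]; exists (fun n s => f @^-1` R n s); split.
- by move=> n s; apply: preimage_closed => //; exact: cR.
- by move=> n s; have [m mP] := Rm n s; exists m => t /mP ->.
- by rewrite AE.
Qed.

Lemma souslin_open (b : nat -> set T) A : regular_space T -> countable_base b ->
  open A -> souslin A.
Proof.
move=> rT bb oA; have [K cK ->] := open_Fsigma rT bb oA.
by apply: souslin_bigcup => n; exact: souslin_closed.
Qed.

End souslin_sets.

(** The Souslin operation does not respect complements, so the induction carries [A] and its
    complement together. *)
Lemma souslin_Borel (T : ptopologicalType) (b : nat -> set T) (A : set T) :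
  regular_space T -> countable_base b -> Borel A -> souslin A.
Proof.
move=> rT bb; suff : @Borel T `<=` [set A | souslin A /\ souslin (~` A)].
  by move=> h /h[].
apply: smallest_sub => [|U oU].
  split=> /=.
  - by split; apply: souslin_closed; [exact: closed0|rewrite setC0; exact: closedT].
  - by move=> C [sC sCC]; rewrite setTD setCK.
  - move=> F sF; split; first by apply: souslin_bigcup => n; exact: (sF n).1.
    by rewrite setC_bigcup; apply: souslin_bigcap => n; exact: (sF n).2.
split; first exact: (souslin_open rT bb).
by apply: souslin_closed; exact: open_closedC.
Qed.

(** By regularity, [f x = y] as soon as [y] lies in the closure of every basic open set containing
    [f x]; this is a countable intersection of Souslin conditions. *)
Lemma souslin_graph (T U : ptopologicalType) b1 b2 (B : set T) (f : T -> U) :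
  regular_space T -> @countable_base T b1 ->
  hausdorff_space U -> regular_space U -> @countable_base U b2 ->
  Borel B -> Borel_fun B f -> souslin [set z : T * U | B z.1 /\ f z.1 = z.2].
Proof.
move=> rT bb1 hU rU bb2 mB mf.
have cfst : continuous (fst : T * U -> T) by move=> z; exact: cvg_fst.
have csnd : continuous (snd : T * U -> U) by move=> z; exact: cvg_snd.
have -> : [set z : T * U | B z.1 /\ f z.1 = z.2] =
    \bigcap_k (fst @^-1` (B `&` f @^-1` b2 k) `&` snd @^-1` closure (b2 k) `|`
               fst @^-1` (B `&` f @^-1` (~` b2 k))).
  apply/seteqP; split=> [[x y]/= [Bx <-] k _|[x y]/= h].
    have [bk|nbk] := pselect (b2 k (f x)); last by right.
    by left; split => //; exact: subset_closure.
  have Bx : B x by case: (h 0%N I) => [[[]]|[]].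
  split => //; apply: contrapT => fxy.
  have [V xV VA] : filter_from (nbhs (f x)) closure (~` [set y]).
    apply: rU; apply: open_nbhs_nbhs; split => //; apply: closed_openC.
    exact: hausdorff_closed_set1.
  have [k bk bV] := bb2.2 _ _ xV.
  case: (h k I) => [[_ /= yk]|[_]]; last exact.
  by apply: (VA y) => //; exact: closureS yk.
apply: souslin_bigcap => k; apply: souslinU; first apply: souslinI.
- apply: souslin_preimage => //; apply: (souslin_Borel rT bb1).
  by apply: mf => //; apply: sub_sigma_algebra; exact: bb2.1.
- by apply: souslin_closed; apply: preimage_closed => //; exact: closed_closure.
- apply: souslin_preimage => //; apply: (souslin_Borel rT bb1).
  apply: mf => //; apply: measurableC.
  by apply: sub_sigma_algebra; exact: bb2.1.
Qed.

(** * Ideals and calibration *)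

Section ideals.
Variables (T : ptopologicalType) (I : set (set T)).
Hypothesis hI : sigma_ideal I.
Implicit Types A B : set T.

(** Smallness for arbitrary sets: projections of Souslin pieces need not be Borel, whereas members
    of [I] are. *)
Definition covered A : Prop := exists2 D, I D & A `<=` D.

Lemma coveredS A B : A `<=` B -> covered B -> covered A.
Proof. by move=> AB [D ID BD]; exists D => //; exact: subset_trans BD. Qed.

Lemma covered_Borel A : Borel A -> covered A -> I A.
Proof. by move=> bA [D ID AD]; have [_ h _] := hI; exact: h AD. Qed.

Lemma covered_bigcup (A : (set T)^nat) :
  (forall n, covered (A n)) -> covered (\bigcup_n A n).
Proof.
move=> h; have /choice[D DP] : forall n, exists D, I D /\ A n `<=` D.
  by move=> n; have [D ID AD] := h n; exists D.
have [_ _ hU] := hI.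
exists (\bigcup_n D n); first by apply: hU => n; exact: (DP n).1.
by apply: subset_bigcup => n _; exact: (DP n).2.
Qed.

Lemma covered_bigcup_countType (J : countType) (j0 : J) (A : J -> set T) :
  (forall j, covered (A j)) -> covered (\bigcup_j A j).
Proof.
move=> h; have [e eP] := countType_enumeration j0.
apply: (@coveredS _ (\bigcup_n A (e n))); last exact: covered_bigcup.
by move=> x [j _ Ajx]; have [n en] := eP j; exists n => //; rewrite en.
Qed.

Lemma coveredU A B : covered A -> covered B -> covered (A `|` B).
Proof.
move=> cA cB; apply: (@coveredS _ (\bigcup_(b : bool) if b then A else B)).
  by move=> x [Ax|Bx]; [exists true|exists false].
by apply: (covered_bigcup_countType true) => -[].
Qed.

End ideals.

Lemma closed_Borel (T : ptopologicalType) (A : set T) : closed A -> Borel A.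
Proof.
move=> cA; rewrite -(setCK A); apply: measurableC.
by apply: sub_sigma_algebra; exact: closed_openC.
Qed.

Lemma compact_Borel (T : ptopologicalType) (K : set T) :
  hausdorff_space T -> compact K -> Borel K.
Proof. by move=> hT cK; apply: closed_Borel; exact: compact_closed. Qed.

Section selection.
Variables (X Y : ptopologicalType) (I : set (set X)).
Hypotheses (htX : hausdorff_space X) (hX : compact [set: X])
  (hY : compact [set: Y]).
Hypotheses (hI : sigma_ideal I) (hIc : calibrated I).
Implicit Types M L : set (X * Y).

Lemma fst_cts : continuous (fst : X * Y -> X).
Proof. by move=> z; exact: cvg_fst. Qed.

Lemma snd_cts : continuous (snd : X * Y -> Y).
Proof. by move=> z; exact: cvg_snd. Qed.

Lemma closed_prod_compact M : closed M -> compact M.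
Proof.
move=> cM; apply: (subclosed_compact cM); last exact: subsetT.
by rewrite -setXTT; exact: compact_setX.
Qed.

Lemma compact_fst M : closed M -> compact (fst @` M).
Proof.
move=> cM; apply: continuous_compact; last exact: closed_prod_compact.
by apply: continuous_subspaceT; exact: fst_cts.
Qed.

Lemma compact_snd M : closed M -> compact (snd @` M).
Proof.
move=> cM; apply: continuous_compact; last exact: closed_prod_compact.
by apply: continuous_subspaceT; exact: snd_cts.
Qed.

(** If the part of [M] over some [C n] has projection outside [I], take that part. Otherwise all
    these projections are compact members of [I], and calibration gives a compact set off them,
    which is lifted back to [M]. *)
Lemma calibrated_selection M (C : (set Y)^nat) :
  closed M -> ~ I (fst @` M) -> (forall n, closed (C n)) ->
  exists L, [/\ closed L, L `<=` M, ~ I (fst @` L) &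
    (exists n, snd @` L `<=` C n) \/ snd @` L `&` \bigcup_n C n = set0].
Proof.
move=> cM nIM cC.
pose N n := M `&` snd @^-1` C n.
have cN n : closed (N n).
  by apply: closedI => //; apply: preimage_closed => //; move=> z _; exact: snd_cts.
have [[n nIN]|/forallNP allN] := pselect (exists n, ~ I (fst @` N n)).
  exists (N n); split => //; first exact: subIsetl.
  by left; exists n => _ [z [_ Cz] <-].
have [|L [cL LM nIL]] := hIc (compact_fst cM) nIM (Kn := fun n => fst @` N n).
  by move=> n; split; [exact: compact_fst|exact: contrapT].
have eL : fst @` (M `&` fst @^-1` L) = L.
  apply/seteqP; split=> [_ [z [_ Lz] <-]//|x Lx].
  by have [[z Mz zx] _] := LM x Lx; exists z => //; split => //=; rewrite zx.
exists (M `&` fst @^-1` L); split; [|exact: subIsetl|by rewrite eL|right].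
  apply: closedI => //; apply: preimage_closed; last exact: compact_closed.
  by move=> z _; exact: fst_cts.
rewrite -subset0 => y [[z [Mz Lz] <-] [n _ Cn]].
by have [_] := LM _ Lz; apply; exists n => //; exists z.
Qed.

End selection.

(** * The fusion *)

(* Finite sequences are stored in reverse, so that the children of [t] are the
   [k :: t]. *)
Fixpoint branch (s : nat -> nat) (n : nat) : seq nat :=
  if n is m.+1 then s m :: branch s m else [::].

Lemma size_branch s n : size (branch s n) = n.
Proof. by elim: n => //= n ->. Qed.

Lemma branch_inj s t n : branch s n = branch t n ->
  forall i, (i < n)%N -> s i = t i.
Proof.
elim: n => // n IH /= [stn /IH st] i.
by rewrite ltnS leq_eqVlt => /predU1P[->//|/st].
Qed.

Lemma branch_build (Q : seq nat -> nat -> Prop) : (forall s, exists k, Q s k) ->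
  exists sg, forall n, Q (branch sg n) (sg n).
Proof.
move=> /choice[k kQ]; pose sq n := iter n (fun s => k s :: s) [::].
exists (fun n => k (sq n)) => n.
have -> : branch (fun n => k (sq n)) n = sq n by elim: n => //= n ->.
exact: kQ.
Qed.

Lemma branch_in (P : set (seq nat)) : P [::] ->
  (forall s, P s -> exists k, P (k :: s)) -> exists sg, forall n, P (branch sg n).
Proof.
move=> P0 PS; have [|sg sgP] := @branch_build (fun s k => P s -> P (k :: s)).
  move=> s; have [/PS[k Pk]|nPs] := pselect (P s); first by exists k.
  by exists 0%N.
by exists sg; elim=> //= n /sgP.
Qed.

(** [G t] collects the points witnessed by a branch extending [t]. Each [R n] depends on finitely
    many values, so [G] far enough along [s] lies in the closed set [R n s]. *)
Lemma souslin_scheme (T : topologicalType) (A : set T) : souslin A ->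
  exists G : seq nat -> set T,
  [/\ G [::] = A, forall t, G t = \bigcup_j G (j :: t)
    & forall s x, (forall n, closure (G (branch s n)) x) -> A x].
Proof.
move=> [R [cR Rm AE]].
exists (fun t => [set x | exists2 s, branch s (size t) = t & forall n, R n s x]).
split.
- rewrite AE; apply/seteqP; split=> x /=; first by move=> [s _ sx]; exists s.
  by move=> [s sx]; exists s.
- move=> t; apply/seteqP; split=> [x [s st sx]|x [j _ [s /= [_ st] sx]]].
    by exists (s (size t)) => //; exists s => //=; rewrite st.
  by exists s.
- move=> s x sx; rewrite AE; exists s => n; have [m mP] := Rm n s.
  have : closure (R n s) x.
    apply: closureS (sx m) => y [t]; rewrite size_branch => ts ty.
    by rewrite -(mP t)//; exact: branch_inj ts.
  exact: cR.
Qed.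

(** * Splitting one node of the fusion *)

Section step.
Variables (R : realType) (X Y : pmetricType R) (I : set (set X)).
Hypotheses (hX : compact [set: X]) (hY : compact [set: Y]).
Hypotheses (hI : sigma_ideal I) (I0 : I set0).
Variables (B : set X) (f : X -> Y) (G : seq nat -> set (X * Y)).
Hypotheses (G0 : G [::] = [set z | B z.1 /\ f z.1 = z.2])
  (GE : forall t, G t = \bigcup_j G (j :: t)).
Variable small : seq nat -> set Y -> Prop.
Hypothesis small_sel : forall s (M : set (X * Y)), closed M -> ~ I (fst @` M) ->
  exists L, [/\ closed L, L `<=` M, ~ I (fst @` L) & small s (snd @` L)].
Hypothesis small_covered : forall s C, compact C -> small s C ->
  covered I (B `&` f @^-1` C).

Definition heavy (t : seq nat) (W : set (X * Y)) : Prop :=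
  ~ covered I (fst @` (G t `&` W)).

(* One step of the fusion: the pieces [c n] of [W] accumulate exactly at the
   points of [L] ([split_accum]), while the closures of their projections to [Y]
   are pairwise disjoint and converge to [snd @` L]. *)
Record splitting (s t : seq nat) (W L : set (X * Y))
    (c : nat -> seq nat * set (X * Y)) : Prop := Splitting {
  split_closed : closed L;
  split_large : ~ I (fst @` L);
  split_small : small s (snd @` L);
  split_child : forall n, exists j, (c n).1 = j :: t;
  split_open : forall n, open (c n).2;
  split_heavy : forall n, heavy (c n).1 (c n).2;
  split_sub : forall n, (c n).2 `<=` W;
  split_diam : forall n, exists z, (c n).2 `<=` ball z (size s).+1%:R^-1;
  split_off : forall n, closure (snd @` (c n).2) `&` snd @` L = set0;
  split_disj : forall n m, n != m ->
    closure (snd @` (c n).2) `&` closure (snd @` (c m).2) = set0;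
  split_lf : forall y, ~ (snd @` L) y -> exists U N, nbhs y U /\
    forall n, (N <= n)%N -> closure (snd @` (c n).2) `&` U = set0;
  split_accum : forall d U, L d -> nbhs d U -> exists n, (c n).2 `<=` U;
  split_hole : closure (snd @` W) `<=` snd @` L \/
    exists y, [/\ closure (snd @` W) y, ~ (snd @` L) y &
      forall n, ~ closure (snd @` (c n).2) y] }.

Lemma scheme_sub t : G t `<=` G [::].
Proof.
elim: t => // j t IH; apply: subset_trans IH; rewrite (GE t).
exact: bigcup_sup.
Qed.

Lemma covered0 : covered I set0.
Proof. by exists set0. Qed.

(** The child [j] is chosen before the neighbourhood [U], so one child serves at all scales. *)
Definition locally_heavy t W : set (X * Y) :=
  [set z | (G t `&` W) z /\ exists j, forall U, open U -> U z -> heavy (j :: t) U].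

Let cbase_prod : exists b, @countable_base (X * Y)%type b.
Proof.
have [b1 h1] := second_countable_base (compact_second_countable hX).
have [b2 h2] := second_countable_base (compact_second_countable hY).
exact: prod_countable_base h1 h2.
Qed.

(** A point of [G t] lies in some child. If it is not locally heavy, a basic open set around it cuts
    out of that child a piece with covered projection; there are countably many such pairs. *)
Lemma covered_not_locally_heavy t W :
  covered I (fst @` ((G t `&` W) `\` locally_heavy t W)).
Proof.
have [b [ob bb]] := cbase_prod.
pose A (jk : nat * nat) : set X :=
  if `[< covered I (fst @` (G (jk.1 :: t) `&` b jk.2)) >]
  then fst @` (G (jk.1 :: t) `&` b jk.2) else set0.
apply: (@coveredS _ _ _ (\bigcup_jk A jk)); last first.
  apply: (covered_bigcup_countType hI (0, 0)%N) => jk; rewrite /A.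
  by case: asboolP => // _; exact: covered0.
move=> _ [z [[Gz Wz] nz] <-]; have := Gz; rewrite GE => -[j _ Gjz].
have [U /not_implyP[oU /not_implyP[Uz /contrapT cU]]] :
    exists U, ~ (open U -> U z -> heavy (j :: t) U).
  by apply/existsNP => h; apply: nz; split => //; exists j.
have [k bz bU] := bb z U (open_nbhs_nbhs (conj oU Uz)).
exists (j, k) => //; rewrite /A /= asboolT; first by exists z.
by apply: coveredS cU => _ [w [Gw /bU Uw] <-]; exists w.
Qed.

(** Otherwise a heavy piece around a locally heavy point of [U] would be covered by the projections
    of [D] and of the points that are not locally heavy. *)
Lemma locally_heavy_avoid t W (D : set (X * Y)) z U :
  open W -> covered I (fst @` (G [::] `&` D)) ->
  closure (locally_heavy t W) z -> nbhs z U ->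
  exists w, [/\ locally_heavy t W w, U w & ~ D w].
Proof.
move=> oW cD zE zU; apply: contrapT => nw.
have [w [[[Gw Ww] [j jP]] Uw]] := zE _ (nbhs_interior zU).
have := jP (W `&` U°) (openI oW (@open_interior _ U)) (conj Ww Uw); apply.
have := coveredU hI (covered_not_locally_heavy t W) cD.
apply: coveredS => _ [v [Gv [Wv Uv]] <-].
have Gtv : G t v by rewrite GE; exists j.
have [Ev|nEv] := pselect (locally_heavy t W v); [right|left]; exists v => //.
split; first exact: scheme_sub Gtv.
apply: contrapT => nDv; apply: nw; exists v; split => //.
exact: interior_subset.
Qed.

Lemma invr_natS_lt (e : R) : 0 < e ->
  exists N, forall n, (N <= n)%N -> n.+1%:R^-1 < e.
Proof.
move=> e0; have [N] := ltr_add_invr e0; rewrite add0r => Ne.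
exists N => n Nn; apply: le_lt_trans Ne.
by rewrite lef_pV2 ?posrE ?ltr0n// ler_nat.
Qed.

(** The closure of the locally heavy points has projection outside [I], so [small_sel] yields [L]
    inside it. The pieces are neighbourhoods of locally heavy points, the [n]-th one close to
    [e (r n)], where [e] is dense in [L] and [r] repeats every index infinitely often. *)
Lemma splitting_exists s t W : open W -> heavy t W ->
  exists L c, splitting s t W L c.
Proof.
move=> oW hW; set E := locally_heavy t W.
have nIE : ~ I (fst @` closure E).
  move=> IE; apply: hW.
  have cE : covered I (fst @` E).
    by exists (fst @` closure E) => //; apply: image_subset; exact: subset_closure.
  have := coveredU hI cE (covered_not_locally_heavy t W).
  apply: coveredS => _ [z Gz <-].
  by have [Ez|nEz] := pselect (E z); [left|right]; exists z.
have [L [cL LE nIL sL]] := small_sel s (@closed_closure _ E) nIE.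
have htY : hausdorff_space Y by exact: metric_hausdorff.
have csL : closed (snd @` L).
  by apply: compact_closed => //; exact: compact_snd.
(* Graph points over the projection of [L] are negligible by [small_covered], so
   [locally_heavy_avoid] gives locally heavy points near [L] whose second coordinate lies off that
   projection. *)
have cGL : covered I (fst @` (G [::] `&` snd @^-1` (snd @` L))).
  apply: coveredS (small_covered (compact_snd hX hY cL) sL).
  move=> _ [[x y]/= [+ Ly] <-]; rewrite G0 => -[/= Bx fxy].
  by split=> //=; rewrite fxy.
have [b hb] := cbase_prod.
have L0 : L !=set0.
  by apply/set0P/eqP => L0; apply: nIL; rewrite L0 image_set0.
have [e eL ed] := dense_sequence hb L0.
have [r rP] := recurrent_enumeration.
(* [Q0] reserves a point [y] for the hole: every piece will have to avoid it. *)
have [Q0 [cQ0 Q0L Q0h]] : exists Q0 : set Y, [/\ closed Q0, Q0 `&` snd @` L = set0 &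
    closure (snd @` W) `<=` snd @` L \/
    exists y, [/\ closure (snd @` W) y, ~ (snd @` L) y & Q0 y]].
  have [WL|/existsNP[y /not_implyP[Wy nLy]]] :=
      pselect (closure (snd @` W) `<=` snd @` L).
    by exists set0; split; [exact: closed0|exact: set0I|left].
  exists [set y]; split; last by right; exists y.
    exact: hausdorff_closed_set1.
  by rewrite -subset0 => _ [-> /nLy].
pose valid (Q : set Y) := closed Q /\ Q `&` snd @` L = set0.
pose good (n : nat) (Q : set Y) (v : nat * set (X * Y)) :=
  [/\ open v.2, heavy (v.1 :: t) v.2, v.2 `<=` W, v.2 `<=` ball (e (r n)) n.+1%:R^-1 &
   (exists z, v.2 `<=` ball z (size s).+1%:R^-1) /\
   closure (snd @` v.2) `&` (Q `|` snd @` L) = set0].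
have ex_good n Q : valid Q -> exists v, good n Q v.
  move=> [cQ QL]; set d := e (r n).
  have dU : nbhs d ((ball d n.+1%:R^-1)° `&` snd @^-1` (~` Q)).
    apply: filterI.
      by apply: nbhs_interior; apply: nbhsx_ballx; rewrite invr_gt0.
    apply: snd_cts; apply: open_nbhs_nbhs; split; first exact: closed_openC.
    move=> Qd; move: QL; rewrite -subset0 => /(_ d.2); apply; split => //.
    by exists d => //; exact: eL.
  have [w [[[Gw Ww] [j jP]] [dw nQw] nLw]] :=
    locally_heavy_avoid oW cGL (LE _ (eL (r n))) dU.
  have [P wP PQ] : filter_from (nbhs w.2) closure (~` (Q `|` snd @` L)).
    apply: uniform_regular; apply: open_nbhs_nbhs; split.
      by apply: closed_openC; exact: closedU.
    by case.
  have wnear : nbhs w (ball d n.+1%:R^-1 `&` ball w (size s).+1%:R^-1 `&` snd @^-1` P `&` W).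
    apply: filterI; last exact: open_nbhs_nbhs.
    apply: filterI; last exact: snd_cts.
    by apply: filterI; [exact: dw|apply: nbhsx_ballx; rewrite invr_gt0].
  move: wnear; rewrite nbhsE => -[V [oV Vw] VP].
  exists (j, V); split => //=; first exact: jP.
  - by move=> v /VP[_ ?].
  - by move=> v /VP[[[? _] _] _].
  - split; first by exists w => v /VP[[[_ ?] _] _].
    rewrite -subset0 => y [Vy Qy]; apply: (PQ y) => //.
    by apply: closureS Vy => _ [v /VP[[_ Pv] _] <-].
have /choice[g gP] : forall nQ, exists v, valid nQ.2 -> good nQ.1 nQ.2 v.
  move=> nQ; have [vQ|nvQ] := pselect (valid nQ.2).
    by have [v hv] := ex_good nQ.1 nQ.2 vQ; exists v.
  by exists (0%N, set0).
(* [Qs n] is what the [n]-th piece has to avoid: the hole chosen above and the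
   closures of the projections of the previous pieces. *)
pose Qs := fix Qs n := if n is m.+1
  then Qs m `|` closure (snd @` (g (m, Qs m)).2) else Q0.
have vQs n : valid (Qs n).
  elim: n => [|n IH] //=; have [_ _ _ _ [_ FQ]] := gP (n, Qs n) IH.
  split; first by apply: closedU; [exact: IH.1|exact: closed_closure].
  rewrite setIUl IH.2 set0U -subset0 => y [Fy Ly].
  by move: FQ; rewrite -subset0 => /(_ y); apply; split => //; right.
have Qmono n m : (n <= m)%N -> Qs n `<=` Qs m.
  elim: m => [|m IH]; first by rewrite leqn0 => /eqP ->.
  rewrite leq_eqVlt => /predU1P[->//|/IH]; move/subset_trans; apply.
  exact: subsetUl.
pose v n := g (n, Qs n).
have vP n : good n (Qs n) (v n) by apply: gP; exact: vQs.
exists L, (fun n => ((v n).1 :: t, (v n).2)); split => //=.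
- by move=> n; exists (v n).1.
- by move=> n; have [] := vP n.
- by move=> n; have [] := vP n.
- by move=> n; have [] := vP n.
- by move=> n; have [_ _ _ _ []] := vP n.
- move=> n; have [_ _ _ _ [_ FQ]] := vP n.
  by rewrite -subset0 -FQ; apply: setIS; exact: subsetUr.
- have dis n m : (n < m)%N ->
      closure (snd @` (v n).2) `&` closure (snd @` (v m).2) = set0.
    move=> nm; have [_ _ _ _ [_ FQ]] := vP m.
    rewrite -subset0 -FQ setIC; apply: setIS; apply: subset_trans (@subsetUl _ _ _).
    by apply: subset_trans (Qmono _ _ nm) => y Fy; right.
  by move=> n m; rewrite neq_ltn => /orP[/dis|/dis]; rewrite 1?setIC.
(* Piece [n] lies within [n.+1%:R^-1] of a point of [L]; meeting the half-radius ball around [y]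
   with [n] large would put a point of the projection of [L] within [eps] of [y]. *)
- move=> y nLy.
  have : nbhs y (~` (snd @` L)).
    by apply: open_nbhs_nbhs; split => //; exact: closed_openC.
  move=> /nbhs_ballP[eps/= eps0 yL].
  have [N NP] := invr_natS_lt (divr_gt0 eps0 (ltr0n R 2)).
  exists (ball y (eps / 2))°, N; split.
    by apply: nbhs_interior; apply: nbhsx_ballx; rewrite divr_gt0.
  move=> n Nn; rewrite -subset0 => y' [Fy' yy'].
  have [_ [[w vw <-] yw]] := Fy' _ (nbhs_interior yy').
  have [_ _ _ /(_ w vw) dw _] := vP n.
  apply: (yL (e (r n)).2); last by exists (e (r n)) => //; exact: eL.
  apply: (@ball_split _ _ w.2); first exact: interior_subset yw.
  by apply: ball_sym; apply: le_ball (ltW (NP n Nn)) _ _; exact: dw.2.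
- move=> d U Ld /nbhs_ballP[eps/= eps0 dU].
  have eps2 : 0 < eps / 2 by rewrite divr_gt0.
  have [k dk] := ed d _ Ld (nbhsx_ballx d _ eps2).
  have [N NP] := invr_natS_lt eps2.
  have [n Nn rn] := rP k N.
  exists n; have [_ _ _ vd _] := vP n.
  apply: subset_trans dU => w /vd; rewrite rn => ekw.
  by apply: (@ball_split _ _ (e k)) => //; apply: le_ball (ltW (NP n Nn)) _ _.
- have [WL|[y [Wy nLy Q0y]]] := Q0h; [by left|right; exists y; split => //].
  move=> n Fy; have [_ _ _ _ [_ FQ]] := vP n.
  move: FQ; rewrite -subset0 => /(_ y); apply; split => //; left.
  exact: (Qmono 0%N).
Qed.

End step.

(** * The limit set of a tree of closed sets *)

Section fusion.
Variables (T : topologicalType) (F L : seq nat -> set T).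
Hypotheses (cF : forall s, closed (F s)) (cL : forall s, closed (L s)).
Hypothesis F_sub : forall s k, F (k :: s) `<=` F s.
Hypothesis F_disj : forall s j k, j != k -> F (j :: s) `&` F (k :: s) = set0.
Hypothesis F_off : forall s k, F (k :: s) `&` L s = set0.
Hypothesis F_lf : forall s y, ~ L s y -> exists U N, nbhs y U /\
  forall n, (N <= n)%N -> F (n :: s) `&` U = set0.

(** A point of [fusion] descends through the nodes until it lands in some [L s], or descends
    forever. The condition is stated node by node so that closedness can be checked at each node
    separately. *)
Definition fusion : set T :=
  F [::] `&` [set y | forall s, F s y -> L s y \/ exists k, F (k :: s) y].

(** Nodes are relatively open: [L s] and the siblings of a child have a closed union by local
    finiteness, and this union misses the child. *)
Lemma fusion_nbhs s y : F s y -> exists2 U, nbhs y U & fusion `&` U `<=` F s.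
Proof.
elim: s y => [|k s IH] y Fy; first by exists setT; [exact: filterT|move=> z [[]]].
have [U yU UF] := IH y (F_sub Fy).
pose A := L s `|` \bigcup_(j in [set j | j != k]) F (j :: s).
have cA : closed A by apply: closed_locally_finite => // x; exact: F_lf.
have nAy : ~ A y.
  move=> [Ly|[j /= jk Fjy]].
    by have := F_off s k; rewrite -subset0 => /(_ y); apply.
  by have := F_disj s jk; rewrite -subset0 => /(_ y); apply.
exists (U `&` ~` A).
  by apply: filterI => //; apply: open_nbhs_nbhs; split=> //; exact: closed_openC.
move=> z [Cz [Uz nAz]]; have Fsz : F s z by apply: UF.
have [Lz|[j Fjz]] := Cz.2 s Fsz; first by case: nAz; left.
by have [<-//|jk] := eqVneq j k; case: nAz; right; exists j.
Qed.

(** Near a limit point in [F s], points of [fusion] lie in [F s] by [fusion_nbhs], hence in the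
    union of [L s] and the children, which is closed. *)
Lemma fusion_closed : closed fusion.
Proof.
move=> y Cy; split.
  by apply: cF; apply: closureS Cy => z [].
move=> s Fsy; have [U yU UF] := fusion_nbhs Fsy.
have cA : closed (L s `|` \bigcup_(j in setT) F (j :: s)).
  by apply: closed_locally_finite => // x; exact: F_lf.
have [|Ly|[j _ Fj]] := cA y; [|by left|by right; exists j].
move=> V yV; have [z [Cz [Uz Vz]]] := Cy _ (filterI yU yV).
exists z; split => //; have [Lz|[j Fjz]] := Cz.2 s (UF z (conj Cz Uz)).
  by left.
by right; exists j.
Qed.

(** Siblings being disjoint, the only nodes containing [y] are the initial segments of [sg]. *)
Lemma fusion_branch sg y : (forall n, F (branch sg n) y) -> fusion y.
Proof.
move=> Fy; split=> [|s Fsy]; first exact: (Fy 0%N).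
suff -> : s = branch sg (size s).
  by right; exists (sg (size s)); have := Fy (size s).+1.
elim: s Fsy => //= k s IH Fksy; have es := IH (F_sub Fksy).
rewrite -es; suff -> : k = sg (size s) by [].
apply/eqP; apply: contrapT => /negP /(F_disj s).
rewrite -subset0 => /(_ y); apply; split => //.
by have := Fy (size s).+1; rewrite /= -es.
Qed.

End fusion.

(** * Construction of the fusion tree *)

Section fusion_tree.
Variables (R : realType) (X Y : pmetricType R) (I : set (set X)).
Hypotheses (hX : compact [set: X]) (hY : compact [set: Y]).
Hypotheses (hI : sigma_ideal I) (hIK : generated_by_compacts I) (I0 : I set0).
Variables (B : set X) (f : X -> Y).
Hypotheses (hB : Borel B) (hf : Borel_fun B f) (hBI : ~ I B).
Variable small : seq nat -> set Y -> Prop.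
Hypothesis small_sel : forall s (M : set (X * Y)), closed M -> ~ I (fst @` M) ->
  exists L, [/\ closed L, L `<=` M, ~ I (fst @` L) & small s (snd @` L)].
Hypothesis small_covered : forall s C, compact C -> small s C ->
  covered I (B `&` f @^-1` C).

(** The interface to the three applications: [tree_hole] and [tree_interior] serve meagerness,
    [tree_open] total disconnectedness, [tree_value] the measure bound, [tree_shrink] all three. *)
Record fusion_tree (C : set Y) (F L : seq nat -> set Y) : Prop := FusionTree {
  tree_compact : compact C;
  tree_large : ~ I (B `&` f @^-1` C);
  tree_small : forall s, small s (L s);
  tree_limit_closed : forall s, closed (L s);
  tree_node_closed : forall s, closed (F s);
  tree_root : C `<=` F [::];
  tree_open : forall s y, F s y -> exists2 U, nbhs y U & C `&` U `<=` F s;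
  tree_step : forall s y, C y -> F s y -> L s y \/ exists k, F (k :: s) y;
  tree_hole : forall s, F s `<=` L s \/ exists2 y, F s y & ~ C y;
  tree_interior : forall s, (F s)° !=set0;
  tree_shrink : forall sg y U, (forall n, F (branch sg n) y) -> nbhs y U ->
    exists n, F (branch sg n) `<=` U;
  tree_value : forall sg, exists2 x, B x & forall n, F (branch sg n) (f x) }.

Theorem fusion_tree_exists : exists C F L, fusion_tree C F L.
Proof.
have htX : hausdorff_space X by exact: metric_hausdorff.
have htY : hausdorff_space Y by exact: metric_hausdorff.
have [b1 hb1] := second_countable_base (compact_second_countable hX).
have [b2 hb2] := second_countable_base (compact_second_countable hY).
have [G [G0 GE Gbranch]] := souslin_scheme
  (souslin_graph (@uniform_regular X) hb1 htY (@uniform_regular Y) hb2 hB hf).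
(* A node carries its address in the Souslin scheme, distinct from its address in the fusion tree:
   siblings may come from the same child of the scheme. *)
pose node := (seq nat * set (X * Y))%type.
have /choice[stg stgP] : forall sn : seq nat * node,
    exists Lc : set (X * Y) * (nat -> node),
    open sn.2.2 -> heavy I G sn.2.1 sn.2.2 ->
    splitting I G small sn.1 sn.2.1 sn.2.2 Lc.1 Lc.2.
  move=> [s [t W]] /=; have [[oW hW]|nW] := pselect (open W /\ heavy I G t W).
    have [L [c sLc]] :=
      splitting_exists hX hY hI I0 G0 GE small_sel small_covered s oW hW.
    by exists (L, c).
  by exists (set0, fun=> ([::], set0)) => oW hW; case: nW.
pose nd := fix nd s : node :=
  if s is k :: s' then (stg (s', nd s')).2 k else ([::], setT).
have ndP s : open (nd s).2 /\ heavy I G (nd s).1 (nd s).2.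
  elim: s => [|k s [IHo IHh]] /=.
    split; first exact: openT.
    rewrite /heavy setIT G0 => cB; apply: hBI; apply: covered_Borel => //.
    by apply: coveredS cB => x Bx; exists (x, f x).
  have sp := stgP (s, nd s) IHo IHh.
  by split; [exact: (split_open sp)|exact: (split_heavy sp)].
have sp s : splitting I G small s (nd s).1 (nd s).2
    (stg (s, nd s)).1 (fun k => nd (k :: s)).
  by have [oW hW] := ndP s; exact: (stgP (s, nd s) oW hW).
pose F s := closure (snd @` (nd s).2).
pose L s := snd @` (stg (s, nd s)).1.
have cF s : closed (F s) by exact: closed_closure.
have cL s : closed (L s).
  by apply: compact_closed => //; apply: compact_snd => //; exact: (split_closed (sp s)).
have F_sub s k : F (k :: s) `<=` F s.
  by apply: closureS; apply: image_subset; exact: (split_sub (sp s)).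
have F_disj s j k : j != k -> F (j :: s) `&` F (k :: s) = set0.
  exact: (split_disj (sp s)).
have F_off s k : F (k :: s) `&` L s = set0 by exact: (split_off (sp s)).
have F_lf s y : ~ L s y -> exists U N, nbhs y U /\
    forall n, (N <= n)%N -> F (n :: s) `&` U = set0.
  exact: (split_lf (sp s)).
pose C := fusion F L.
(* Along a branch the closures of the scheme pieces decrease and are nonempty by heaviness.
   Compactness gives a common point, and the scheme puts it in the graph. *)
have CB sg : exists2 z, G [::] z & forall n, closure (nd (branch sg n)).2 z.
  have /choice[tau tauP] : forall n, exists j,
      (nd (branch sg n.+1)).1 = j :: (nd (branch sg n)).1.
    by move=> n; exact: (split_child (sp (branch sg n))).
  have ndE n : (nd (branch sg n)).1 = branch tau n.
    by elim: n => //= n <-; exact: tauP.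
  pose D n := G (branch tau n) `&` (nd (branch sg n)).2.
  have [||||z zD] := @closed_decreasing_nonempty (X * Y)%type (fun n => closure (D n)).
  - by rewrite -setXTT; exact: compact_setX.
  - by move=> n; exact: closed_closure.
  - move=> n; apply/set0P/eqP => /closure_eq0 D0.
    have [_] := ndP (branch sg n); rewrite /heavy ndE -/(D n) D0 image_set0.
    by apply; exact: covered0.
  - move=> n; apply: closureS => z [Gz nz]; split.
      by rewrite GE; exists (tau n).
    exact: (split_sub (sp (branch sg n))) nz.
  have zG : G [::] z.
    by rewrite G0; apply: (Gbranch tau) => n; apply: closureS (zD n) => w [].
  by exists z => // n; apply: closureS (zD n) => w [].
have Fsnd s z : closure (nd s).2 z -> F s z.2.
  move=> zn U zU; have [w [nw Uw]] : (nd s).2 `&` snd @^-1` U !=set0.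
    by apply: zn; exact: snd_cts.
  by exists w.2; split => //; exists w.
have cC : compact C.
  by apply: (subclosed_compact _ hY) => //; exact: fusion_closed.
have value sg : exists z, [/\ B z.1, f z.1 = z.2, C z.2 &
    forall n, closure (nd (branch sg n)).2 z].
  have [z + zn] := CB sg; rewrite G0 => -[Bz fz]; exists z; split => //.
  by apply: fusion_branch => // n; apply: Fsnd.
exists C, F, L; split => //.
- move=> IBC; have [D [[K cK DE] ID BCD]] := hIK IBC.
  have IK m : I (K m).
    have [_ h _] := hI; apply: (h D) => //; first exact: compact_Borel.
    by rewrite DE => x Kx; exists m.
  (* At level [m], step into a piece whose closure misses [K m]: this is possible
     since [K m], being in [I], does not contain the limit set of the node. *)
  have [|sg sgP] := @branch_build
      (fun s k => closure (nd (k :: s)).2 `<=` fst @^-1` (~` K (size s))).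
    move=> s; have [d Ld nKd] : exists2 d, (stg (s, nd s)).1 d & ~ K (size s) d.1.
      apply: contrapT => /forall2NP nd'; apply: (split_large (sp s)).
      apply: covered_Borel => //.
        by apply: compact_Borel => //; apply: compact_fst => //; exact: (split_closed (sp s)).
      exists (K (size s)) => // _ [d Ld <-].
      by have [//|/contrapT] := nd' d.
    have [V dV VK] : filter_from (nbhs d) closure (fst @^-1` (~` K (size s))).
      apply: uniform_regular; apply: fst_cts; apply: open_nbhs_nbhs; split => //.
      by apply: closed_openC; exact: compact_closed.
    have [k kV] := split_accum (sp s) Ld dV.
    by exists k; apply: subset_trans VK; exact: closureS.
  have [z [Bz fz Cz zn]] := value sg.
  have : D z.1 by apply: BCD; split => //=; rewrite fz.
  rewrite DE => -[m _]; have := sgP m z; rewrite size_branch; apply.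
  exact: (zn m.+1).
- by move=> s; exact: (split_small (sp s)).
- by move=> y [].
- by move=> s y; exact: fusion_nbhs.
- by move=> s y [_]; apply.
- move=> s; have [|[y [Fy nLy nFy]]] := split_hole (sp s); [by left|right].
  by exists y => // -[_ /(_ s Fy)[//|[k /nFy]]].
- move=> s; have [oW hW] := ndP s.
  have [w Ww] : (nd s).2 !=set0.
    apply/set0P/eqP => W0; apply: hW; rewrite W0 setI0 image_set0.
    exact: covered0.
  exists w.2; have : nbhs w (nd s).2 by exact: open_nbhs_nbhs.
  move=> [[P Q] [/= wP wQ] PQ]; apply: filterS wQ => y Qy; apply: subset_closure.
  by exists (w.1, y) => //; apply: PQ; split => //=; exact: nbhs_singleton.
(* [split_diam] at level [N] bounds the children, hence level [N.+1]. One quarter of [e] bounds the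
   piece, another pays for its closure. *)
- move=> sg y U Fy /nbhs_ballP[e/= e0 yU].
  have e4 : 0 < e / 2 / 2 by rewrite !divr_gt0.
  have [N /(_ N (leqnn _)) Ne] := invr_natS_lt e4.
  have [c cN] := split_diam (sp (branch sg N)) (sg N).
  rewrite size_branch in cN.
  have near_c y' : F (branch sg N.+1) y' -> ball c.2 (e / 2) y'.
    move=> Fy'; have [_ [[w ww <-] y'w]] := Fy' _ (nbhsx_ballx y' _ e4).
    apply: (@ball_split _ _ w.2); last exact: ball_sym.
    by apply: le_ball (ltW Ne) _ _; have [] := cN w ww.
  exists N.+1 => y' Fy'; apply: yU; apply: (@ball_split _ _ c.2).
    by apply: ball_sym; apply: near_c; exact: Fy.
  exact: near_c.
- move=> sg; have [z [Bz fz _ zn]] := value sg.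
  by exists z.1 => // n; rewrite fz; exact: Fsnd.
Qed.

Lemma tree_branch C F L y : fusion_tree C F L -> C y -> (forall s, ~ L s y) ->
  exists sg, forall n, F (branch sg n) y.
Proof.
move=> tr Cy nL; apply: (@branch_in (fun s => F s y)).
  exact: (tree_root tr).
by move=> s Fy; have [/nL|] := tree_step tr Cy Fy.
Qed.

End fusion_tree.

(** * Zero-dimensional and nowhere dense sets *)

Lemma nowhere_dense_sub (T : topologicalType) (A B : set T) :
  A `<=` B -> nowhere_dense B -> nowhere_dense A.
Proof.
rewrite /nowhere_dense => AB B0; rewrite -subset0 -B0; apply: interiorS.
exact: closureS.
Qed.

Lemma nowhere_dense_set1 (T : topologicalType) (x : T) :
  closed [set x] -> no_isolated_points T -> nowhere_dense [set x].
Proof.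
move=> cx iT; rewrite /nowhere_dense -(iffLR (closure_id _) cx) -subset0 => y xy.
have := nbhs_singleton xy; move=> /= yx; subst y.
have : isolated setT x by split; [rewrite inE|exists [set x] => //; rewrite setIT].
by rewrite iT.
Qed.

Section zero_dimensional_sets.
Variables (R : realType) (Y : pmetricType R).
Implicit Types A V Z : set Y.

(** A relatively clopen neighbourhood and its complement in [A] are enlarged to disjoint open
    subsets [V] and [V'] of [Y]; a point of [A] on the boundary of [V] would lie in [V']. *)
Lemma zero_dimensional_nbhs A x (e : R) : zero_dimensional_subset A -> A x ->
  0 < e -> exists V, [/\ open V, V x, V `<=` ball x e &
    (closure V `\` V) `&` A = set0].
Proof.
move=> zA Ax e0; have e2 : 0 < e / 2 by rewrite divr_gt0.
pose x' : set_type A := SigSub (mem_set Ax).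
have cts : continuous (set_val : set_type A -> Y) by exact: initial_continuous.
have [D [[[U oU UD] cD] Dx DB]] : exists D : set (set_type A),
    [/\ clopen D, D x' & D `<=` set_val @^-1` ball x (e / 2)].
  by apply: zA; apply: cts; exact: nbhsx_ballx.
have [U' oU' UD'] : open (~` D) by exact: closed_openC.
have valA a (Aa : A a) : set_val (SigSub (mem_set Aa) : set_type A) = a by [].
have UE a : A a -> U a <-> (set_val @` D) a.
  move=> Aa; split=> [Ua|[d + <-]]; last by rewrite -UD.
  by exists (SigSub (mem_set Aa)) => //; rewrite -UD.
have U'E a : A a -> U' a <-> ~ (set_val @` D) a.
  move=> Aa; split=> [Ua [d Dd da]|nDa].
    have : (set_val @^-1` U') d by rewrite /preimage /= da.
    by rewrite UD'; apply.
  have : (~` D) (SigSub (mem_set Aa)) by move=> Da; apply: nDa; exists (SigSub (mem_set Aa)).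
  by rewrite -UD'.
(* If two balls of half these radii met, the centre with the smaller radius would lie in the full
   ball around the other; so half balls centred on the two sides are disjoint. The cap [e] keeps [V]
   inside [ball x e]. *)
have /choice[r rP] : forall a, exists r : R, [/\ 0 < r, r <= e &
    (A a -> (U a -> ball a r `<=` U) /\ (U' a -> ball a r `<=` U'))].
  move=> a.
  have small (W : set Y) : open W -> exists r : R, [/\ 0 < r, r <= e & W a -> ball a r `<=` W].
    move=> oW; have [Wa|nWa] := pselect (W a); last by exists e; split.
    have /nbhs_ballP[r/= r0 rW] := open_nbhs_nbhs (conj oW Wa).
    exists (Num.min r e); split=> [||_]; first by rewrite lt_min r0.
      by rewrite ge_min lexx orbT.
    by apply: subset_trans rW; apply: le_ball; rewrite ge_min lexx.
  have [r1 [r10 r1e h1]] := small U oU; have [r2 [r20 r2e h2]] := small U' oU'.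
  exists (Num.min r1 r2); split; first by rewrite lt_min r10.
    by rewrite ge_min r1e.
  move=> Aa; split=> [/h1|/h2]; apply: subset_trans; apply: le_ball.
    by rewrite ge_min lexx.
  by rewrite ge_min lexx orbT.
pose nb a := (ball a (r a / 2))°.
have nba a : nb a a.
  by have [r0 _ _] := rP a; apply: nbhsx_ballx; rewrite divr_gt0.
pose V := \bigcup_(a in A `&` U) nb a; pose V' := \bigcup_(a in A `&` U') nb a.
have oV' : open V' by apply: bigcup_open => a _; exact: open_interior.
have disj v : V v -> V' v -> False.
  move=> [a [Aa Ua] /interior_subset av] [a' [Aa' Ua'] /interior_subset a'v].
  have [_ _ /(_ Aa)[/(_ Ua) aU _]] := rP a.
  have [_ _ /(_ Aa')[_ /(_ Ua') aU']] := rP a'.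
  have [le|/ltW le] := leP (r a) (r a').
    have /aU' : ball a' (r a') a.
      apply: (ball_split a'v); apply: ball_sym; apply: le_ball av.
      by rewrite ler_pM2r// invr_gt0.
    by move/(U'E _ Aa); apply; exact/UE.
  have /aU/(UE _ Aa') : ball a (r a) a'.
    apply: (ball_split av); apply: ball_sym; apply: le_ball a'v.
    by rewrite ler_pM2r// invr_gt0.
  by move: Ua' => /(U'E _ Aa').
exists V; split.
- by apply: bigcup_open => a _; exact: open_interior.
- by exists x => //; split => //; apply/(UE _ Ax); exists x'.
- move=> v [a [Aa /(UE _ Aa)[d Dd da]] /interior_subset av].
  apply: (@ball_split _ _ a); first by rewrite -da; exact: DB.
  apply: le_ball av; have [_ re _] := rP a.
  by rewrite ler_pM2r// invr_gt0.
- rewrite -subset0 => y [[cVy nVy] Ay].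
  have [Uy|nUy] := pselect (U y); first by apply: nVy; exists y.
  have V'y : V' y by exists y => //; split => //; apply/(U'E _ Ay) => /(UE _ Ay).
  have [v [Vv V'v]] := cVy _ (open_nbhs_nbhs (conj oV' V'y)).
  exact: disj Vv V'v.
Qed.

Lemma small_balls_eq (x y : Y) : (forall m : nat, exists z : Y,
  ball z m.+1%:R^-1 x /\ ball z m.+1%:R^-1 y) -> x = y.
Proof.
move=> h; apply/eqP; apply: contrapT => /negP; rewrite -mdist_gt0 => d0.
have d2 : 0 < mdist x y / 2 by rewrite divr_gt0.
have [N /(_ N (leqnn _)) Nd] := invr_natS_lt d2.
have [z [zx zy]] := h N.
have : ball x (mdist x y) y.
  apply: (@ball_split _ _ z); first by apply: ball_sym; exact: le_ball (ltW Nd) _ zx.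
  exact: le_ball (ltW Nd) _ zy.
by rewrite ballEmdist /= ltxx.
Qed.

(* The sets [C n] are the boundaries of countably many small open sets covering
   [A], together with the complements of their unions. *)
Lemma zero_dimensional_avoiding A : compact [set: Y] ->
  zero_dimensional_subset A ->
  exists C : (set Y)^nat, [/\ forall n, closed (C n), forall n, C n `&` A = set0 &
    forall Z, Z `&` \bigcup_n C n = set0 -> totally_disconnected Z].
Proof.
move=> hY zA.
have [b [ob bb]] := second_countable_base (compact_second_countable hY).
pose good m V := [/\ open V, (closure V `\` V) `&` A = set0 &
  exists z, V `<=` ball z m.+1%:R^-1].
(* [V (m, i)] is a good set of scale [m] containing [b i] whenever one exists; the empty set, itself
   good, is the default. *)
have /choice[V VP] : forall mi : nat * nat, exists V, good mi.1 V /\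
    ((exists2 W, good mi.1 W & b mi.2 `<=` W) -> b mi.2 `<=` V).
  move=> [m i] /=; have [[W gW bW]|nW] := pselect (exists2 W, good m W & b i `<=` W).
    by exists W.
  exists set0; split => //; split; first exact: open0.
    by rewrite closure0 set0D set0I.
  by exists point.
(* [Some i] codes the boundary of [V (m, i)], and [None] the complement of the union over [i]. *)
have [e eP] := countType_enumeration (0%N, None : option nat).
pose C n := if (e n).2 is Some i then closure (V ((e n).1, i)) `\` V ((e n).1, i)
  else ~` \bigcup_i V ((e n).1, i).
exists C; split.
- move=> n; rewrite /C; case: (e n).2 => [i|].
    apply: closedI; first exact: closed_closure.
    by apply: open_closedC; have [[]] := VP ((e n).1, i).
  by apply: open_closedC; apply: bigcup_open => i _; have [[]] := VP ((e n).1, i).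
- move=> n; rewrite /C; case: (e n).2 => [i|]; first by have [[]] := VP ((e n).1, i).
  rewrite -subset0 => x [nV Ax]; apply: nV; set m := (e n).1.
  have m0 : 0 < m.+1%:R^-1 :> R by rewrite invr_gt0.
  have [W [oW Wx WB WA]] := zero_dimensional_nbhs zA Ax m0.
  have [i bix biW] := bb x W (open_nbhs_nbhs (conj oW Wx)).
  exists i => //; have [_ /= h] := VP (m, i); apply: h bix.
  by exists W => //; split => //; exists x.
- move=> Z ZC; apply/totally_disconnectedP => E EZ cE x y Ex Ey.
  have nC n z : E z -> ~ C n z.
    by move=> Ez Cz; move: ZC; rewrite -subset0 => /(_ z); apply; split;
      [exact: EZ|exists n].
  apply: small_balls_eq => m.
  have [i Vx] : exists i, V (m, i) x.
    have [n en] := eP (m, None); have := nC n x Ex; rewrite /C en /=.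
    by move/contrapT => [i _ Vx]; exists i.
  have [oV _ [z Vz]] := (VP (m, i)).1.
  (* [E] misses the boundary of [V (m, i)], whose trace on [E] is therefore clopen. *)
  have EV : E `&` V (m, i) = E.
    apply: cE; [by exists x|by exists (V (m, i))|].
    exists (closure (V (m, i))); first exact: closed_closure.
    apply/seteqP; split=> w [Ew Vw]; split => //; first exact: subset_closure.
    have [n en] := eP (m, Some i); have := nC n w Ew; rewrite /C en /=.
    by move=> h; apply: contrapT => nVw; apply: h.
  exists z; split; first exact: Vz.
  by apply: Vz; move: Ey; rewrite -EV => -[].
Qed.

End zero_dimensional_sets.

(** * Regularity of Borel measures *)

Lemma measure_geometric_cover d (T : measurableType d) (R : realType)
    (mu : {measure set T -> \bar R}) (A : set T) (F : (set T)^nat) (e : R) :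
  0 <= e -> measurable A -> (forall n, measurable (F n)) -> A `<=` \bigcup_n F n ->
  (forall n, mu (F n) <= (e / (2 ^ n.+1)%:R)%:E)%E -> (mu A <= e%:E)%E.
Proof.
move=> e0 mA mF AF Fe; apply: le_trans (epsilon_trick0 xpredT e0).
apply: le_trans (measure_sigma_subadditive mu mF mA AF) _.
exact: lee_nneseries.
Qed.

Lemma measure_decreasing_lt d (T : measurableType d) (R : realType)
    (mu : {measure set T -> \bar R}) (F : (set T)^nat) (e : R) :
  (mu (F 0%N) < +oo)%E -> (forall n, measurable (F n)) ->
  (forall n, F n.+1 `<=` F n) -> mu (\bigcap_n F n) = 0%E -> 0 < e ->
  exists n, (mu (F n) < e%:E)%E.
Proof.
move=> F0 mF dF F00 e0.
have mono : {homo F : n m / (n <= m)%N >-> (m <= n)%O}.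
  by apply: homo_leq => [x|y x z xy yz|n]; [|exact: le_trans yz xy|exact/subsetPset].
have [|N _ NP] := nonincreasing_cvg_mu F0 mF (bigcapT_measurable mF) mono
  (t := [set x | (x < e%:E)%E]).
  rewrite F00; apply: open_nbhs_nbhs; split; last by rewrite /= lte_fin.
  exact: open_ereal_lt_ereal.
by exists N; exact: (NP N (leqnn N)).
Qed.

Lemma measure_eq0_invS d (T : measurableType d) (R : realType)
    (mu : {measure set T -> \bar R}) (A : set T) :
  (forall m : nat, mu A <= (m.+1%:R^-1)%:E)%E -> mu A = 0%E.
Proof.
move=> h; apply/eqP; rewrite eq_le measure_ge0 andbT; apply/lee_addgt0Pr => e e0.
have [N /(_ N (leqnn _)) Ne] := invr_natS_lt e0.
by rewrite add0e; apply: le_trans (h N) _; rewrite lee_fin ltW.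
Qed.

Section regularity.
Variables (R : realType) (Y : pmetricType R) (b : nat -> set Y).
Hypothesis hb : countable_base b.
Variable nu : {measure set (borelType Y) -> \bar R}.
Hypothesis nu_fin : (nu setT < +oo)%E.
Implicit Types A : set Y.

(** Approximation up to a null set by an F-sigma set passes directly to countable unions, unlike
    approximation by a single closed set. *)
Definition inner_Fsigma A : Prop := exists K : (set Y)^nat,
  [/\ forall n, closed (K n), \bigcup_n K n `<=` A & nu (A `\` \bigcup_n K n) = 0%E].

Lemma inner_Fsigma_closed A (e : R) : Borel A -> inner_Fsigma A -> 0 < e ->
  exists F, [/\ closed F, F `<=` A & (nu (A `\` F) < e%:E)%E].
Proof.
move=> mA [K [cK KA K0]] e0.
pose S n := \bigcup_(k in [set k | (k <= n)%N]) K k.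
have cS n : closed (S n).
  apply: closed_bigcup => [|k _]; last exact: cK.
  by apply: (sub_finite_set _ (finite_II n.+1)) => k /=; rewrite ltnS.
have [||||n nP] := @measure_decreasing_lt _ _ _ nu (fun n => A `\` S n) e _ _ _ _ e0.
- apply: le_lt_trans nu_fin; apply: le_measure; rewrite ?inE //.
  by apply: measurableD => //; exact: closed_Borel.
- by move=> n; apply: measurableD => //; exact: closed_Borel.
- by move=> n x [Ax nS]; split => // -[k /= kn Kk]; apply: nS; exists k => //=; exact: leqW.
- rewrite -[RHS]K0; congr (nu _); apply/seteqP; split=> x.
    move=> h; split; first by have [] := h 0%N I.
    by move=> [k _ Kk]; have [_] := h k I; apply; exists k => /=.
  by move=> [Ax nK] n _; split => // -[k _ Kk]; apply: nK; exists k.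
- exists (S n); split; [exact: cS| |exact: nP].
  by apply: subset_trans KA => x [k _ Kk]; exists k.
Qed.

(** Induction on the property for [A] and its complement, which reduces complements of unions to
    countable intersections. *)
Lemma inner_Fsigma_Borel A : Borel A -> inner_Fsigma A.
Proof.
move=> mA; suff : @Borel Y `<=` [set A | [/\ Borel A, inner_Fsigma A & inner_Fsigma (~` A)]].
  by move=> /(_ A mA)[].
have inner_closed C : closed C -> inner_Fsigma C.
  move=> cC; exists (fun=> C); split => //; first by move=> x [].
  rewrite (_ : _ `\` _ = set0) ?measure0// -subset0 => x [Cx]; apply.
  by exists 0%N.
have inner_open U : open U -> inner_Fsigma U.
  move=> oU; have [K cK UK] := open_Fsigma (@uniform_regular Y) hb oU.
  by exists K; split; rewrite // -UK ?setDv ?measure0.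
have inner_bigcup (F : (set Y)^nat) : (forall n, Borel (F n)) ->
    (forall n, inner_Fsigma (F n)) -> inner_Fsigma (\bigcup_n F n).
  move=> mF /choice[K KP].
  have [e eP] := countType_enumeration (0%N, 0%N).
  exists (fun n => K (e n).1 (e n).2); split.
  - by move=> n; have [] := KP (e n).1.
  - move=> x [n _ Kx]; exists (e n).1 => //; have [_ + _] := KP (e n).1.
    by apply; exists (e n).2.
  - apply: (@subset_measure0 _ _ _ nu _ (\bigcup_n (F n `\` \bigcup_k K n k))).
    + apply: measurableD; first by apply: bigcup_measurable => n _; exact: mF.
      by apply: bigcup_measurable => n _; apply: closed_Borel; have [] := KP (e n).1.
    + apply: bigcup_measurable => n _; apply: measurableD; first exact: mF.
      by apply: bigcup_measurable => k _; apply: closed_Borel; have [] := KP n.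
    + move=> x [[n _ Fx] nK]; exists n => //; split => // -[k _ Kx]; apply: nK.
      by have [i ei] := eP (n, k); exists i => //; rewrite ei.
    + apply: measure_negligible.
        apply: bigcup_measurable => n _; apply: measurableD; first exact: mF.
        by apply: bigcup_measurable => k _; apply: closed_Borel; have [] := KP n.
      apply: negligible_bigcup => n; apply/negligibleP; last by have [] := KP n.
      apply: measurableD; first exact: mF.
      by apply: bigcup_measurable => k _; apply: closed_Borel; have [] := KP n.
have inner_bigcap (F : (set Y)^nat) : (forall n, Borel (F n)) ->
    (forall n, inner_Fsigma (F n)) -> inner_Fsigma (\bigcap_n F n).
  move=> mF iF.
  (* For fixed [m] the losses sum over [k] to at most [m.+1%:R^-1]; intersecting over [k] and then
     uniting over [m] leaves a null remainder. *)
  have /choice[K KP] : forall mk : nat * nat, exists K, [/\ closed K, K `<=` F mk.2 &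
      (nu (F mk.2 `\` K) < (mk.1.+1%:R^-1 / (2 ^ mk.2.+1)%:R)%:E)%E].
    move=> [m k]; apply: inner_Fsigma_closed; [exact: mF|exact: iF|].
    by rewrite divr_gt0 ?invr_gt0 ?ltr0n ?expn_gt0.
  have mK mk : Borel (K mk) by apply: closed_Borel; have [] := KP mk.
  have mI : Borel (\bigcap_n F n) by apply: bigcapT_measurable => n; exact: mF.
  have mJ m : Borel (\bigcap_k K (m, k)).
    by apply: bigcapT_measurable => k; exact: mK.
  exists (fun m => \bigcap_k K (m, k)); split.
  - by move=> m; apply: closed_bigI => k _; have [] := KP (m, k).
  - by move=> x [m _ Kx] k _; have [_ + _] := KP (m, k); apply; exact: Kx.
  - apply: measure_eq0_invS => m.
    apply: (@measure_geometric_cover _ _ _ nu _ (fun k => F k `\` K (m, k))).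
    + by rewrite invr_ge0.
    + by apply: measurableD; [exact: mI|apply: bigcup_measurable => m2 _; exact: mJ].
    + by move=> n; apply: measurableD; [exact: mF|exact: mK].
    + move=> x [Fx nK]; apply: contrapT => nx; apply: nK; exists m => // k _.
      by apply: contrapT => nKx; apply: nx; exists k => //; split => //; exact: Fx.
    + by move=> k; apply: ltW; have [] := KP (m, k).
apply: smallest_sub => [|U oU]; last first.
  split; [exact: sub_sigma_algebra|exact: inner_open|].
  by apply: inner_closed; exact: open_closedC.
split=> /=.
- split; [exact: measurable0|apply: inner_closed; exact: closed0|].
  by rewrite setC0; apply: inner_closed; exact: closedT.
- by move=> C [mC iC iCC]; rewrite setTD setCK; split => //; exact: measurableC.
- move=> F hF; split.
  + by apply: bigcup_measurable => n _; have [] := hF n.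
  + by apply: inner_bigcup => n; have [] := hF n.
  + rewrite setC_bigcup; apply: inner_bigcap => n; have [mF _ iF] := hF n => //.
    exact: measurableC.
Qed.

End regularity.

(** * Closed covers for sigma-finite nonatomic measures *)

Section sigma_finite_covers.
Variables (R : realType) (Y : pmetricType R) (b : nat -> set Y).
Hypothesis hb : countable_base b.
Variable mu : {measure set (borelType Y) -> \bar R}.

Let htY : hausdorff_space Y. Proof. exact: metric_hausdorff. Qed.

Lemma nonatomic_set1 (y : Y) : nonatomic mu -> mu [set y] = 0%E.
Proof.
move=> na; apply: contrapT => /eqP y0.
have [||A [mA Ay A0 Alt]] := na [set y].
- exact: (@closed_Borel Y _ (hausdorff_closed_set1 htY)).
- by rewrite lt_neqAle eq_sym y0 measure_ge0.
have [yA|nyA] := pselect (A y).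
  move: Alt; rewrite (_ : A = [set y]) ?ltxx//.
  by apply/seteqP; split => // _ ->.
move: A0; rewrite (_ : A = set0) ?measure0 ?ltxx// -subset0 => z Az.
by apply: nyA; rewrite -(Ay z Az).
Qed.

(** Inner regularity is applied to the restrictions of [mu] to sets of finite measure. *)
Lemma sigma_finite_closed_cover : sigma_finite [set: borelType Y] mu ->
  exists K : (set Y)^nat, [/\ forall n, closed (K n),
    forall n, (mu (K n) < +oo)%E & mu (~` \bigcup_n K n) = 0%E].
Proof.
move=> [A AT Afin].
have mA n : Borel (A n) by have [] := Afin n.
have /choice[K KP] : forall n, inner_Fsigma (mrestr mu (mA n)) (A n).
  move=> n; apply: (inner_Fsigma_Borel hb); last exact: mA.
  have [_] := Afin n; rewrite -{1}(setTI (A n)); exact.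
have mK n : Borel (\bigcup_k K n k).
  by apply: bigcup_measurable => k _; apply: closed_Borel; have [] := KP n.
have [e eP] := countType_enumeration (0%N, 0%N).
pose C n := K (e n).1 (e n).2.
have cC n : closed (C n) by have [h _ _] := KP (e n).1; exact: h.
exists C; split => //.
- move=> n; have [_ KA _] := KP (e n).1; have [_] := Afin (e n).1.
  apply: le_lt_trans; apply: le_measure; rewrite ?inE.
  + exact: closed_Borel.
  + exact: mA.
  + by apply: subset_trans KA => x Cx; exists (e n).2.
- have mAK n : Borel (A n `\` \bigcup_k K n k).
    by apply: measurableD; [exact: mA|exact: mK].
  have mC : Borel (\bigcup_n C n).
    by apply: bigcup_measurable => n _; exact: closed_Borel.
  apply: (@subset_measure0 _ _ _ mu _ (\bigcup_n (A n `\` \bigcup_k K n k))).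
  + exact: measurableC.
  + by apply: bigcup_measurable => n _; exact: mAK.
  + move=> x nC; have [n _ Ax] : (\bigcup_n A n) x by rewrite -AT.
    exists n => //; split => // -[k _ Kx]; apply: nC.
    by have [i ei] := eP (n, k); exists i => //; rewrite /C ei.
  + apply: measure_negligible; first by apply: bigcup_measurable => n _; exact: mAK.
    apply: negligible_bigcup => n; apply/negligibleP; first exact: mAK.
    have [_ _] := KP n; rewrite /mrestr => h; rewrite -[RHS]h; congr (mu _).
    by rewrite setIidl//; exact: subDsetl.
Qed.

(** The traces on [K] of closures of shrinking balls decrease to a subset of the null set of the
    single point [y]; finiteness on [K] permits continuity from above. *)
Lemma nonatomic_small_nbhs (K : set Y) (y : Y) (e : R) : nonatomic mu ->
  closed K -> (mu K < +oo)%E -> 0 < e ->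
  exists2 V, nbhs y V & (mu (K `&` closure V) < e%:E)%E.
Proof.
move=> na cK Kfin e0.
pose V (n : nat) := ball y n.+1%:R^-1.
have mKV n : Borel (K `&` closure (V n)).
  by apply: closed_Borel; apply: closedI => //; exact: closed_closure.
have [||||n nV] := @measure_decreasing_lt _ _ _ mu (fun n => K `&` closure (V n)) e _ _ _ _ e0.
- apply: le_lt_trans Kfin; apply: le_measure; rewrite ?inE; [exact: mKV|exact: closed_Borel|].
  exact: subIsetl.
- exact: mKV.
- move=> n; apply: setIS; apply: closureS; apply: le_ball.
  by rewrite lef_pV2 ?posrE ?ltr0n// ler_nat.
- apply: (@subset_measure0 _ _ _ mu _ [set y]).
  + exact: bigcapT_measurable mKV.
  + exact: (@closed_Borel Y _ (hausdorff_closed_set1 htY)).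
  + move=> z Kz; apply: small_balls_eq => m; exists y.
    have m2 : 0 < m.+1%:R^-1 / 2 :> R by rewrite divr_gt0 ?invr_gt0.
    have [n /(_ n (leqnn _)) nm] := invr_natS_lt m2.
    have [_ zV] := Kz n Logic.I; have [w [yw zw]] := zV _ (nbhsx_ballx z _ m2).
    split; last by apply: ballxx; rewrite invr_gt0.
    apply: (@ball_split _ _ w); last exact: ball_sym.
    exact: le_ball (ltW nm) _ yw.
  + exact: nonatomic_set1.
- by exists (V n) => //; apply: nbhsx_ballx; rewrite invr_gt0.
Qed.

(** Keep the sets [K n] cut by closures of basic sets whose measure is below [e];
    [nonatomic_small_nbhs] shows that they still cover every [K n]. *)
Lemma nonatomic_small_cover (e : R) : sigma_finite [set: borelType Y] mu ->
  nonatomic mu -> 0 < e ->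
  exists C : (set Y)^nat, [/\ forall n, closed (C n),
    forall n, (mu (C n) < e%:E)%E & mu (~` \bigcup_n C n) = 0%E].
Proof.
move=> /sigma_finite_closed_cover[K [cK Kfin K0]] na e0.
have [p pP] := countType_enumeration (0%N, 0%N).
pose D n := K (p n).1 `&` closure (b (p n).2).
pose C n := if (mu (D n) < e%:E)%E then D n else set0.
have cC n : closed (C n).
  rewrite /C; case: ifP => _; last exact: closed0.
  by apply: closedI => //; exact: closed_closure.
exists C; split => //.
  by move=> n; rewrite /C; case: ifP => // _; rewrite measure0 lte_fin.
rewrite -[RHS]K0; congr (mu (~` _)); apply/seteqP; split=> x [n _].
  by rewrite /C; case: ifP => // _ [Kx _]; exists (p n).1.
move=> Kx; have [V xV Ve] := nonatomic_small_nbhs x na (cK n) (Kfin n) e0.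
have [i bx bV] := hb.2 _ _ xV.
have [k pk] := pP (n, i).
have De : (mu (D k) < e%:E)%E.
  apply: le_lt_trans Ve; rewrite /D pk /=; apply: le_measure; rewrite ?inE.
  - by apply: closed_Borel; apply: closedI => //; exact: closed_closure.
  - by apply: closed_Borel; apply: closedI => //; exact: closed_closure.
  - by apply: setIS; exact: closureS.
exists k => //; rewrite /C De /D pk; split => //; exact: subset_closure.
Qed.

End sigma_finite_covers.

(** * The three selections *)

Section applications.
Variables (R : realType) (X Y : pmetricType R) (I : set (set X)).
Hypotheses (hX : compact [set: X]) (hY : compact [set: Y]).
Hypotheses (hI : sigma_ideal I) (hIK : generated_by_compacts I).
Hypotheses (hIc : calibrated I) (I0 : I set0).
Variables (B : set X) (f : X -> Y).
Hypotheses (hB : Borel B) (hf : Borel_fun B f) (hBI : ~ I B).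

Let htX : hausdorff_space X. Proof. exact: metric_hausdorff. Qed.
Let htY : hausdorff_space Y. Proof. exact: metric_hausdorff. Qed.

Let base_Y : exists b : nat -> set Y, countable_base b.
Proof. exact: second_countable_base (compact_second_countable hY). Qed.

(** By contradiction: if no [C] works, nowhere dense compacta have covered preimages, which is the
    hypothesis [small_covered] of the fusion. The other two applications begin likewise. *)
Lemma meager_preimage : no_isolated_points Y ->
  exists C : set Y, [/\ compact C, meager C & ~ I (B `&` f @^-1` C)].
Proof.
move=> iY; apply: contrapT => noC.
have [b bb] := base_Y.
have [a _ ad] : exists2 a : nat -> Y, (forall n, [set: Y] (a n)) &
    forall x U, [set: Y] x -> nbhs x U -> exists n, U (a n).
  by apply: dense_sequence bb _; exists point.
pose small (s : seq nat) (C : set Y) := nowhere_dense C.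
have small_cov s C : compact C -> small s C -> covered I (B `&` f @^-1` C).
  move=> cC sC; apply: contrapT => nI; apply: noC; exists C; split => //.
    by exists (fun=> C) => //; rewrite bigcup_const//; exists 0%N.
  by move=> IC; apply: nI; exists (B `&` f @^-1` C).
have small_sel s (M : set (X * Y)) : closed M -> ~ I (fst @` M) ->
    exists L, [/\ closed L, L `<=` M, ~ I (fst @` L) & small s (snd @` L)].
  move=> cM nIM.
  have [L [cL LM nIL h]] := calibrated_selection htX hX hY hIc cM nIM
    (C := fun n => [set a n]) (fun n => hausdorff_closed_set1 (x := a n) htY).
  exists L; split => //.
  (* Either the projection lies in one point, not isolated, or it is closed and misses a dense
     sequence. *)
  case: h => [[n Lan]|disj].
    exact: nowhere_dense_sub Lan (nowhere_dense_set1 (hausdorff_closed_set1 htY) iY).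
  have cl : closed (snd @` L) by apply: compact_closed => //; exact: compact_snd.
  rewrite /small /nowhere_dense -(iffLR (closure_id _) cl) -subset0 => y yL.
  have [n Lan] : exists n, (snd @` L) (a n) by exact: (ad y).
  by move: disj; rewrite -subset0 => /(_ (a n)); apply; split => //; exists n.
have [C [F [L tr]]] := fusion_tree_exists hX hY hI hIK I0 hB hf hBI small_sel small_cov.
pose Br := [set y | C y /\ forall s, ~ L s y].
apply: noC; exists C; split; [exact: tree_compact tr| |exact: tree_large tr].
have [e eP] := countType_enumeration ([::] : seq nat).
exists (fun n => if n is m.+1 then C `&` L (e m) else Br).
  move=> [|m]; last first.
    by apply: nowhere_dense_sub (tree_small tr (e m)); exact: subIsetr.
  (* An interior point of the closure of [Br] would bring a whole node into [C]. The node then has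
     no hole, so it lies in its nowhere dense [L] although it has interior. *)
  rewrite /nowhere_dense -subset0 => y yBr.
  have [z [Brz zBr]] := interior_subset yBr _ (nbhs_interior yBr).
  have [sg Fz] := tree_branch tr Brz.1 Brz.2.
  have BrC : closure Br `<=` C.
    have cC := compact_closed htY (tree_compact tr).
    by rewrite [X in _ `<=` X](iffLR (closure_id _) cC); apply: closureS => w [].
  have [n Fn] := tree_shrink tr Fz zBr.
  have [FL|[w /Fn Fw nCw]] := tree_hole tr (branch sg n); last exact/nCw/BrC.
  have [w Fw] := tree_interior tr (branch sg n).
  suff : interior (closure (L (branch sg n))) w by rewrite (tree_small tr).
  by apply: interiorS Fw; apply: subset_trans FL _; exact: subset_closure.
apply/seteqP; split=> [y Cy|y [[|m] _ []//]].
have [[s Ls]|/forallNP nL] := pselect (exists s, L s y); last by exists 0%N.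
by have [m em] := eP s; exists m.+1 => //; rewrite em.
Qed.

Lemma totally_disconnected_selection (M : set (X * Y)) :
  countable_dimensional Y -> closed M -> ~ I (fst @` M) ->
  exists L, [/\ closed L, L `<=` M, ~ I (fst @` L) &
    totally_disconnected (snd @` L)].
Proof.
move=> [A zA YA] cM nIM; apply: contrapT => noL.
pose valid N := [/\ closed N, N `<=` M & ~ I (fst @` N)].
(* The second alternative of the selection would give a totally disconnected projection, so the
   first holds, and the chosen closed set misses [A n]. *)
have step n N : valid N -> exists N', [/\ valid N', N' `<=` N & snd @` N' `&` A n = set0].
  move=> [cN NM nIN].
  have [C [cC CA Ctd]] := zero_dimensional_avoiding hY (zA n).
  have [L [cL LN nIL [[k LC]|LC]]] := calibrated_selection htX hX hY hIc cN nIN cC.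
    exists L; split => //; first by split => //; exact: subset_trans NM.
    by rewrite -subset0 -(CA k); exact: setSI.
  case: noL; exists L; split => //; first exact: subset_trans NM.
  exact: Ctd.
have /choice[g gP] : forall nN : nat * set (X * Y), exists N', valid nN.2 ->
    [/\ valid N', N' `<=` nN.2 & snd @` N' `&` A nN.1 = set0].
  move=> [n N] /=; have [vN|nvN] := pselect (valid N); last by exists set0.
  by have [N' h] := step n N vN; exists N'.
pose Ms := fix Ms n := if n is m.+1 then g (m, Ms m) else M.
have vMs n : valid (Ms n).
  by elim: n => [|n IH]; [split|have [] := gP (n, Ms n) IH].
have [||||z zM] := @closed_decreasing_nonempty (X * Y)%type Ms.
- by rewrite -setXTT; exact: compact_setX.
- by move=> n; have [] := vMs n.
- move=> n; apply/set0P/eqP => M0; have [_ _] := vMs n; apply.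
  by rewrite M0 image_set0.
- by move=> n; have [] := gP (n, Ms n) (vMs n).
have [n _ An] : (\bigcup_n A n) z.2 by rewrite -YA.
have [_ _] := gP (n, Ms n) (vMs n); rewrite -subset0 => /(_ z.2); apply.
by split => //; exists z => //; exact: (zM n.+1).
Qed.

Lemma zero_dimensional_preimage : countable_dimensional Y ->
  exists C : set Y,
    [/\ compact C, zero_dimensional_subset C & ~ I (B `&` f @^-1` C)].
Proof.
move=> cdY; apply: contrapT => noC.
pose small (s : seq nat) (C : set Y) := totally_disconnected C.
have small_cov s C : compact C -> small s C -> covered I (B `&` f @^-1` C).
  move=> cC sC; apply: contrapT => nI; apply: noC; exists C; split => //.
    exact: zero_dimensional_subset_compact.
  by move=> IC; apply: nI; exists (B `&` f @^-1` C).
have small_sel s (M : set (X * Y)) : closed M -> ~ I (fst @` M) ->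
    exists L, [/\ closed L, L `<=` M, ~ I (fst @` L) & small s (snd @` L)].
  exact: totally_disconnected_selection.
have [C [F [L tr]]] := fusion_tree_exists hX hY hI hIK I0 hB hf hBI small_sel small_cov.
have cC := tree_compact tr.
apply: noC; exists C; split; [exact: cC| |exact: tree_large tr].
apply: zero_dimensional_subset_compact => //.
apply/totally_disconnectedP => E EC cE x y Ex Ey; apply: contrapT => xy.
have [||sg EF] := @branch_in (fun s => E `<=` F s).
(* A connected [E] in [C] that meets a child lies in it, since nodes are relatively clopen in [C];
   meeting no child, it would lie in the totally disconnected [L s]. So [E] follows a branch, and
   nodes shrink along it. *)
- by apply: subset_trans EC _; exact: tree_root tr.
- move=> s EF.
  suff [k [w [Ew Fw]]] : exists k, E `&` F (k :: s) !=set0.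
    exists k; suff <- : E `&` F (k :: s) = E by exact: subIsetr.
    apply: cE; [by exists w| |by exists (F (k :: s)) => //; exact: tree_node_closed tr _].
    pose O := \bigcup_(U in [set U | open U /\ C `&` U `<=` F (k :: s)]) U.
    exists O; first by apply: bigcup_open => U [].
    apply/seteqP; split=> v [Ev].
      move=> /(tree_open tr)[U]; rewrite nbhsE => -[W [oW Wv] WU] UF; split=> //.
      by exists W => //; split => // t [Ct /WU Ut]; exact: UF.
    by move=> [U [_ UF] Uv]; split=> //; apply: UF; split => //; exact: EC.
  apply: contrapT => nk; apply: xy.
  have /totally_disconnectedP tL := tree_small tr s.
  apply: (tL E) => // v Ev; have [//|[k Fk]] := tree_step tr (EC v Ev) (EF v Ev).
  by case: nk; exists k, v.
apply: xy; apply: htY => U V xU yV.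
have [n nU] := tree_shrink tr (fun n => EF n x Ex) xU.
by exists y; split; [exact/nU/EF|exact: nbhs_singleton].
Qed.

Lemma finite_measure_preimage (mu : {measure set (borelType Y) -> \bar R}) :
  sigma_finite [set: borelType Y] mu -> nonatomic mu ->
  exists C : set Y, [/\ compact C, (mu C < +oo)%E & ~ I (B `&` f @^-1` C)].
Proof.
move=> sf na; apply: contrapT => noC.
have compactY (C : set Y) : closed C -> compact C.
  by move=> cC; exact: (subclosed_compact cC hY).
have [b hb] := base_Y.
have fin_cov (C : set Y) : compact C -> (mu C < +oo)%E -> covered I (B `&` f @^-1` C).
  move=> cC sC; apply: contrapT => nI; apply: noC; exists C; split => //.
  by move=> IC; apply: nI; exists (B `&` f @^-1` C).
have [K [cK Kfin K0]] := sigma_finite_closed_cover hb sf.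
(* Running the fusion over [B'] forces the values at branches into the null set [N]. [B'] is not in
   [I] because, under [noC], the preimages of the [K n] are covered. *)
pose N := ~` \bigcup_n K n; pose B' := B `&` f @^-1` N.
have mN : Borel N.
  by apply: measurableC; apply: bigcup_measurable => n _; exact: closed_Borel.
have hB' : Borel B' by exact: hf.
have hf' : Borel_fun B' f by apply: measurable_funS hf => //; exact: subIsetl.
have hB'I : ~ I B'.
  move=> IB'; apply: hBI; apply: covered_Borel => //.
  have cB' : covered I B' by exists B'.
  have cK' : covered I (\bigcup_n (B `&` f @^-1` K n)).
    by apply: covered_bigcup => // n; apply: fin_cov => //; exact: compactY.
  apply: coveredS (coveredU hI cB' cK') => x Bx.
  have [[n _ Kx]|nK] := pselect ((\bigcup_n K n) (f x)); last by left.
  by right; exists n.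
(* The bounds, indexed by the codes of nodes, sum to at most 1 over the tree. *)
pose small (s : seq nat) (C : set Y) :=
  (mu C < (1 / (2 ^ (pickle s).+1)%:R)%:E)%E.
have small_cov s C : compact C -> small s C -> covered I (B' `&` f @^-1` C).
  move=> cC sC; apply: coveredS (fin_cov C cC (lt_le_trans sC (leey _))).
  by apply: setSI; exact: subIsetl.
have small_sel s (M : set (X * Y)) : closed M -> ~ I (fst @` M) ->
    exists L, [/\ closed L, L `<=` M, ~ I (fst @` L) & small s (snd @` L)].
  move=> cM nIM; set e : R := 1 / (2 ^ (pickle s).+1)%:R.
  have e0 : 0 < e by rewrite divr_gt0 ?ltr0n ?expn_gt0.
  have [C [cC Ce C0]] := nonatomic_small_cover hb sf na e0.
  have [L [cL LM nIL h]] := calibrated_selection htX hX hY hIc cM nIM cC.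
  have bL : Borel (snd @` L) by apply: compact_Borel => //; exact: compact_snd.
  exists L; split => //; rewrite /small -/e; case: h => [[n Ln]|LC].
    apply: le_lt_trans (Ce n); apply: le_measure; rewrite ?inE //.
    exact: closed_Borel.
  have -> : mu (snd @` L) = 0%E.
    apply: subset_measure0 C0 => //.
      by apply: measurableC; apply: bigcup_measurable => n _; exact: closed_Borel.
    by apply/disjoints_subset.
  by rewrite lte_fin.
have [C [F [L tr]]] :=
  fusion_tree_exists hX hY hI hIK I0 hB' hf' hB'I small_sel small_cov.
have cC := tree_compact tr.
have bC : Borel C by exact: compact_Borel.
apply: noC; exists C; split => //; last first.
  move=> IBC; apply: (tree_large tr).
  have [_ h _] := hI; apply: (h _ _ IBC).
    exact: hf'.
  by apply: setSI; exact: subIsetl.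
(* With [pickle_inv] each node appears only at its own code, matching its bound; other indices get
   the empty set. *)
pose L' n : set Y := if pickle_inv n is Some s then L s else set0.
have bL' n : @Borel Y (L' n).
  rewrite /L'; case: pickle_inv => [s|]; last exact: measurable0.
  by apply: closed_Borel; exact: (tree_limit_closed tr).
(* A point of [C] outside every [L s] lies on a branch, where [tree_shrink] identifies it with the
   value of [f] from [tree_value]. *)
have CL : C `<=` \bigcup_n L' n `|` N.
  move=> y Cy; have [[s Ls]|/forallNP nL] := pselect (exists s, L s y).
    by left; exists (pickle s) => //; rewrite /L' pickleK_inv.
  right; have [sg Fy] := tree_branch tr Cy nL.
  have [x [_ Nx] Fx] := tree_value tr sg.
  suff -> : y = f x by [].
  apply: htY => U V yU xV; have [n nU] := tree_shrink tr Fy yU.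
  by exists (f x); split; [exact/nU/Fx|exact: nbhs_singleton].
have bLU : @Borel Y (\bigcup_n L' n) by apply: bigcup_measurable => n _; exact: bL'.
have : (mu (\bigcup_n L' n) <= 1%:E)%E.
  apply: (@measure_geometric_cover _ _ _ mu _ L') => // n.
  rewrite /L'; case E : (pickle_inv n) => [s|]; last first.
    by rewrite measure0 lee_fin divr_ge0.
  have := pickle_invK (T := seq nat) n; rewrite /ocancel E /= => <-.
  exact: ltW (tree_small tr s).
move=> L1; apply: (@le_lt_trans _ _ (mu (\bigcup_n L' n `|` N))).
  by apply: le_measure; rewrite ?inE //; exact: measurableU.
rewrite measureU0//; exact: le_lt_trans L1 (ltey _).
Qed.

End applications.

Theorem theorem1p1 (R : realType) (X Y : pmetricType R)
    (hX : compact [set: X]) (hX' : no_isolated_points X)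
    (hY : compact [set: Y]) (hY' : no_isolated_points Y)
    (I : set (set X)) (hI : sigma_ideal I) (hIK : generated_by_compacts I)
    (hIc : calibrated I) (hI1 : forall x : X, I [set x])
    (B : set X) (hB : Borel B) (hBI : ~ I B)
    (f : X -> Y) (hf : Borel_fun B f) :
  [/\ exists C : set Y,
        [/\ compact C, meager C & ~ I (B `&` f @^-1` C)],
      countable_dimensional Y ->
        exists C : set Y,
          [/\ compact C, zero_dimensional_subset C & ~ I (B `&` f @^-1` C)]
    & forall mu : {measure set (borelType Y) -> \bar R},
        sigma_finite [set: borelType Y] mu -> nonatomic mu ->
        exists C : set Y,
          [/\ compact C, (mu C < +oo)%E & ~ I (B `&` f @^-1` C)]].
Proof.
have I0 : I set0.
  have [_ h _] := hI; apply: (h [set point]) => //; exact: measurable0.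
split; first exact: meager_preimage.
  exact: zero_dimensional_preimage.
by move=> mu; exact: finite_measure_preimage.
Qed.
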